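(* Let $Z=\{P_1,\dots,P_r\}\subset\mathbb{P}^2$ be a finite set of points such that $\alpha(I(kZ))-\alpha(I((k-1)Z))=2$ for some integer $k\ge2$. Let $C$ be a divisor of degree $d=\alpha(I(kZ))$ vanishing to order at least $k$ at every point of $Z$. Then every irreducible component of $C$ is a rational curve.
   Context: Work over an algebraically closed field $\mathbb{K}$ of characteristic zero, $R=\mathbb{K}[x_0,x_1,x_2]$. For $Z=\{P_1,\dots,P_r\}$, $I(P_i)$ is the homogeneous maximal ideal of $P_i$ and $I(kZ)=I(P_1)^k\cap\dots\cap I(P_r)^k$. For a homogeneous ideal $J$, $\alpha(J)=\min\{n:J_n\ne0\}$ is its initial degree. *)

(* Defs.v *)
From HB Require Import structures.
From mathcomp Require Import all_boot all_order all_algebra.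
From mathcomp Require Import mpoly.
Set Implicit Arguments. Unset Strict Implicit. Unset Printing Implicit Defensive.
Import Order.TTheory GRing.Theory.
Local Open Scope ring_scope.

(* R = K[x0,x1,x2] is {mpoly K[3]}; a point of P^2 is given by homogeneous
   coordinates P : 'I_3 -> K, not all zero. *)

Section Defs.
Variable K : closedFieldType.

Definition pt_nonzero (P : 'I_3 -> K) : Prop := exists j, P j != 0.

(* The homogeneous maximal ideal I(P): polynomials vanishing on the whole
   line of representatives of P (equivalently, all homogeneous components
   vanish at P). *)
Definition in_IP (P : 'I_3 -> K) (f : {mpoly K[3]}) : Prop :=
  forall c : K, f.@[fun i => c * P i] = 0.

Definition in_IPpow (P : 'I_3 -> K) (k : nat) (f : {mpoly K[3]}) : Prop :=
  exists s : seq ({mpoly K[3]} * seq {mpoly K[3]}),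
    f = \sum_(x <- s) x.1 * \prod_(h <- x.2) h /\
    forall x, x \in s -> size x.2 = k /\ forall h, h \in x.2 -> in_IP P h.

Definition in_IkZ (r : nat) (Z : 'I_r -> 'I_3 -> K) (k : nat)
    (f : {mpoly K[3]}) : Prop :=
  forall i, in_IPpow (Z i) k f.

Definition is_alpha (J : {mpoly K[3]} -> Prop) (dg : nat) : Prop :=
  (exists f : {mpoly K[3]}, [/\ f != 0, f \is dg.-homog & J f]) /\
  forall n, (n < dg)%N -> forall f : {mpoly K[3]}, f \is n.-homog -> J f -> f = 0.

Definition mconstant (f : {mpoly K[3]}) : Prop := (msize f <= 1)%N.

Definition mirreducible (g : {mpoly K[3]}) : Prop :=
  ~ mconstant g /\ forall a b : {mpoly K[3]}, g = a * b -> mconstant a \/ mconstant b.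

Definition irr_component (g F : {mpoly K[3]}) : Prop :=
  mirreducible g /\ exists h, F = g * h.

Definition proj_distinct (u v : 'I_3 -> K) : Prop :=
  exists i j, u i * v j != u j * v i.

(* The plane curve g = 0 is rational: it admits a nonconstant rational
   parametrization t |-> (a0(t) : a1(t) : a2(t)) from P^1. *)
Definition rational_curve (g : {mpoly K[3]}) : Prop :=
  exists a : 'I_3 -> {poly K},
    (forall t : K, g.@[fun i => (a i).[t]] = 0) /\
    exists t1 t2 : K, proj_distinct (fun i => (a i).[t1]) (fun i => (a i).[t2]).

End Defs.

(* Main.v *)
Require Import Defs.
From HB Require Import structures.
From mathcomp Require Import all_boot all_order all_algebra.
From mathcomp Require Import mpoly.
From mathcomp Require Import ring zify.
From Stdlib Require Import Classical.
Import Order.TTheory GRing.Theory.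
Set Implicit Arguments. Unset Strict Implicit. Unset Printing Implicit Defensive.
Local Open Scope ring_scope.

(** Let [g] be an irreducible component of [F], of degree [gam] and of
    multiplicity [m_i] at [P_i].  If a nonzero form of degree [gam - 3] had order
    at least [m_i - 1] at every [P_i], its product with [F / g] would have degree
    [d - 3] and order at least [k - 1] along [Z], against
    [alpha (I((k-1)Z)) = d - 2].  Counting conditions, the sum [S] of the
    [m_i (m_i - 1) / 2] is therefore at least the arithmetic genus
    [(gam - 1) (gam - 2) / 2], and the Bezout inequality gives the converse: the
    curve has genus zero, all of it accounted for by the points [P_i].

    In an affine chart, let [J s] be the ideal of the polynomials that coincide on
    the curve with one of order at least [s_P] at each marked point [P].  Its
    codimension is the sum of the [m_P s_P - m_P (m_P - 1) / 2] for
    [s_P >= m_P - 1], and [J s * J s' <= J (s + s')]; comparing dimensions in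
    multiplication by [f] in [J s] yields Bezout.  Adding conditions at a simple
    point [Q], one finds a pencil [H0, H1] of residual degree one, and a polynomial
    [M] such that [M], [M x] and [M y] lie in a system of dimension [gam + 1] on
    the curve.  That system is spanned by the [H0^a H1^(gam - a)], so that the
    coordinates are binary forms in [H0, H1] up to the common factor [M]. *)

(** * Dimension of one subspace relative to another in a [K]-algebra *)

Section RelativeDimension.
Variables (K : fieldType) (A : comNzRingType) (io : {rmorphism K -> A}).

Implicit Types U X Y : A -> Prop.

Definition lcomb n (c : 'rV[K]_n) (e : 'I_n -> A) : A :=
  \sum_i io (c 0 i) * e i.

Definition subspace U := U 0 /\ forall c x y, U x -> U y -> U (io c * x + y).

Definition independent_mod U n (e : 'I_n -> A) :=
  forall c : 'rV[K]_n, U (lcomb c e) -> c = 0.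

(* [dim (X / (X \cap U)) >= n], where this dimension may be infinite. *)
Definition dim_ge X U n :=
  exists e : 'I_n -> A, (forall i, X (e i)) /\ independent_mod U e.

Definition dim_le X U n := ~ dim_ge X U n.+1.

Lemma subspaceD U x y : subspace U -> U x -> U y -> U (x + y).
Proof. by case=> _ Us Ux Uy; have := Us 1 x y Ux Uy; rewrite rmorph1 mul1r. Qed.

Lemma subspaceZ U c x : subspace U -> U x -> U (io c * x).
Proof. by case=> U0 Us Ux; have := Us c x 0 Ux U0; rewrite addr0. Qed.

Lemma subspaceB U x y : subspace U -> U x -> U y -> U (x - y).
Proof.
by case=> _ Us Ux Uy; have := Us (-1) y x Uy Ux; rewrite rmorphN1 mulN1r addrC.
Qed.

Lemma subspaceDr U x y : subspace U -> U y -> U (x + y) -> U x.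
Proof. by move=> sU Uy Uxy; rewrite -(addrK y x); apply: subspaceB. Qed.

Lemma subspace_sum U (I : finType) (F : I -> A) :
  subspace U -> (forall i, U (F i)) -> U (\sum_i F i).
Proof.
move=> sU UF; elim/big_ind: _ => // [|x y]; first by case: sU.
exact: subspaceD.
Qed.

Lemma subspace_lcomb U n c (e : 'I_n -> A) :
  subspace U -> (forall i, U (e i)) -> U (lcomb c e).
Proof. by move=> sU Ue; apply: subspace_sum => // i; apply: subspaceZ. Qed.

Lemma lcombD n c c' (e : 'I_n -> A) : lcomb (c + c') e = lcomb c e + lcomb c' e.
Proof.
rewrite -big_split; apply: eq_bigr => i _ /=.
by rewrite mxE rmorphD mulrDl.
Qed.

Lemma lcombZ n a c (e : 'I_n -> A) : lcomb (a *: c) e = io a * lcomb c e.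
Proof.
by rewrite mulr_sumr; apply: eq_bigr => i _ /=; rewrite mxE rmorphM mulrA.
Qed.

Lemma lcomb0 n (e : 'I_n -> A) : lcomb 0 e = 0.
Proof. by rewrite /lcomb big1 // => i _; rewrite mxE rmorph0 mul0r. Qed.

Lemma lcomb_mulmx m n (u : 'rV_m) (B : 'M_(m, n)) (e : 'I_n -> A) :
  lcomb u (fun i => lcomb (row i B) e) = lcomb (u *m B) e.
Proof.
rewrite /lcomb; under eq_bigr do rewrite mulr_sumr.
rewrite exchange_big; apply: eq_bigr => j _ /=.
rewrite mxE rmorph_sum mulr_suml; apply: eq_bigr => i _ /=.
by rewrite mxE rmorphM mulrA.
Qed.

Lemma lcomb_mul n c (f : A) (e : 'I_n -> A) :
  lcomb c (fun i => f * e i) = f * lcomb c e.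
Proof. by rewrite mulr_sumr; apply: eq_bigr => i _; rewrite mulrCA. Qed.

Lemma lcomb_add n c (e e' : 'I_n -> A) :
  lcomb c (fun i => e i + e' i) = lcomb c e + lcomb c e'.
Proof. by rewrite -big_split; apply: eq_bigr => i _; rewrite mulrDr. Qed.

(** Membership in [S] need not be decidable, so no basis is computed: by excluded middle [B] either
    contains [S] or can be enlarged by a vector of [S], and the rank bounds the number of
    enlargements. *)
Lemma subspace_mxP n (S : 'rV[K]_n -> Prop) :
    S 0 -> (forall a u v, S u -> S v -> S (a *: u + v)) ->
  exists B : 'M[K]_n, forall u, S u <-> (u <= B)%MS.
Proof.
move=> S0 SD.
suff: forall k (B : 'M[K]_n), (n - \rank B <= k)%N ->
    (forall u, (u <= B)%MS -> S u) ->
    exists B : 'M[K]_n, forall u, S u <-> (u <= B)%MS.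
  by move=> /(_ n 0); apply=> [|u]; rewrite ?leq_subr // submx0 => /eqP->.
elim=> [|k IHk] B rB BS.
  have fB : row_full B by rewrite /row_full eqn_leq rank_leq_col -subn_eq0 -leqn0.
  exists B => u; split=> [_|]; first exact: submx_full.
  exact: BS.
have [SB|/not_all_ex_not[u SuB]] := classic (forall u, S u -> (u <= B)%MS).
  by exists B => u; split; [apply: SB|apply: BS].
have [Su nuB] : S u /\ ~ (u <= B)%MS by apply: imply_to_and.
apply: (IHk (B + u)%MS) => [|v /sub_addsmxP[[w1 w2] /= ->]]; last first.
  have -> : w2 *m u = w2 0 0 *: u by rewrite [w2]mx11_scalar mul_scalar_mx !mxE mulr1n.
  by rewrite addrC; apply: SD => //; apply: BS; apply: submxMl.
have : (B < B + u)%MS by rewrite ltmxE addsmxSl addsmx_sub submx_refl; apply/negP.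
by move/rank_ltmx => ltB; lia.
Qed.

Lemma dim_ge_leq X U m n : (m <= n)%N -> dim_ge X U n -> dim_ge X U m.
Proof.
move=> le_mn [e [Xe ie]].
exists (fun i => e (widen_ord le_mn i)); split=> // c Uc.
pose c' : 'rV[K]_n := \row_j (if insub (val j) is Some i then c 0 i else 0).
suff c'0 : c' = 0.
  apply/rowP => i; move/rowP/(_ (widen_ord le_mn i)): c'0; rewrite !mxE /=.
  by rewrite valK.
apply: ie; suff -> : lcomb c' e = lcomb c (fun i => e (widen_ord le_mn i)) by [].
(* Both factors become functions on [nat], zero out of range, so that the two sums differ only in
   their bounds. *)
rewrite /lcomb; pose G k := if insub k is Some i then io (c 0 i) else 0.
pose E k := if insub k is Some j then e j else 0.
transitivity (\sum_(j < n) G j * E j).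
  apply: eq_bigr => j _; rewrite mxE /G /E valK.
  by case: insub => //=; rewrite rmorph0.
transitivity (\sum_(j < m) G j * E j); last first.
  apply: eq_bigr => i _; rewrite /G valK /E; congr (_ * _).
  have lt_in : (i < n)%N := leq_trans (ltn_ord i) le_mn.
  by rewrite insubT; congr e; apply: val_inj.
rewrite (big_ord_widen n (fun k => G k * E k) le_mn) [RHS]big_mkcond /=.
apply: eq_bigr => j _; case: ifP => // jm.
by rewrite /G insubF ?jm // mul0r.
Qed.

Lemma dim_ge_le X U m n : dim_ge X U m -> dim_le X U n -> (m <= n)%N.
Proof.
by move=> Xm Xn; rewrite leqNgt; apply/negP => ltnm; apply: Xn; apply: dim_ge_leq Xm.
Qed.

Lemma dim_ge_sub X X' U U' n :
    (forall x, X x -> X' x) -> (forall x, U' x -> U x) ->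
  dim_ge X U n -> dim_ge X' U' n.
Proof.
by move=> sX sU [e [Xe ie]]; exists e; split=> [i|c /sU]; [apply/sX/Xe|apply: ie].
Qed.

Lemma dim_le_sub X X' U U' n :
    (forall x, X' x -> X x) -> (forall x, U x -> U' x) ->
  dim_le X U n -> dim_le X' U' n.
Proof. by move=> sX sU Xn /(dim_ge_sub sX sU). Qed.

Lemma dim_ge_mod X U V n : subspace X -> (forall x, X x -> V x -> U x) ->
  dim_ge X U n -> dim_ge X V n.
Proof.
move=> sX XVU [e [Xe ie]]; exists e; split=> // c Vc.
by apply: ie; apply: XVU => //; apply: subspace_lcomb.
Qed.

Lemma dim_geD X Y U a b : subspace Y -> (forall x, U x -> Y x) ->
    (forall x, Y x -> X x) ->
  dim_ge X Y a -> dim_ge Y U b -> dim_ge X U (a + b).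
Proof.
move=> sY UY YX [e1 [X1 i1]] [e2 [Y2 i2]].
exists (fun i => match split i with inl j => e1 j | inr j => e2 j end).
split=> [i|c Uc]; first by case: split => j; [apply: X1|apply/YX/Y2].
have def_c : lcomb (lsubmx c) e1 + lcomb (rsubmx c) e2 = lcomb c
    (fun i => match split i with inl j => e1 j | inr j => e2 j end).
  rewrite /lcomb big_split_ord /=; congr (_ + _); apply: eq_bigr => i _.
    by rewrite mxE; case: split_ordP => j /eqP; rewrite ?eq_lshift ?eq_lrshift // => /eqP->.
  by rewrite mxE; case: split_ordP => j /eqP; rewrite ?eq_rshift ?eq_rlshift // => /eqP->.
have c10 : lsubmx c = 0.
  apply: i1; apply: (subspaceDr sY (y := lcomb (rsubmx c) e2)).
    exact: subspace_lcomb.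
  by apply: UY; rewrite def_c.
have c20 : rsubmx c = 0 by apply: i2; rewrite -[lcomb _ _]add0r -(lcomb0 e1) -c10 def_c.
by rewrite -[c]hsubmxK c10 c20 row_mx0.
Qed.

(** Subadditivity of dimension, in contrapositive form. The coefficient rows whose combination lies
    in [Y] form a row space [B]. A basis of [B] gives a family in both [X] and [Y], a basis of its
    complement one that is independent modulo [Y], and the two ranks add up to [a + b + 1]. *)
Lemma dim_ge_split X Y U a b : subspace X -> subspace Y -> 
  dim_ge X U (a + b).+1 -> dim_ge X Y a.+1 \/ dim_ge (fun x => X x /\ Y x) U b.+1.
Proof.
move=> sX [Y0 Ys]; set n := (a + b).+1 => -[e [Xe ie]].
have [|c u v|B SB] := @subspace_mxP n (fun c => Y (lcomb c e)).
- by rewrite lcomb0.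
- by rewrite lcombD lcombZ; apply: Ys.
have eqr := mxrank_compl B.
have [le_b|lt_b] := leqP b.+1 (\rank B); last left.
  right; apply: (dim_ge_leq le_b).
  exists (fun i => lcomb (row i (row_base B)) e); split=> [i|c].
    split; first exact: subspace_lcomb.
    by apply/SB; rewrite (submx_trans (row_sub _ _)) // eq_row_base.
  rewrite lcomb_mulmx => /ie/eqP; rewrite mulmx_free_eq0 ?row_base_free //.
  by move/eqP.
apply: (@dim_ge_leq _ _ _ (\rank (B^C)%MS)); first by rewrite eqr; lia.
exists (fun i => lcomb (row i (row_base (B^C)%MS)) e); split=> [i|c].
  exact: subspace_lcomb.
rewrite lcomb_mulmx => /SB cB.
have cC : (c *m row_base B^C <= B^C)%MS.
  by rewrite (submx_trans (submxMl _ _)) // eq_row_base.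
have : (c *m row_base B^C <= B :&: B^C)%MS by rewrite sub_capmx cB cC.
by rewrite capmx_compl submx0 mulmx_free_eq0 ?row_base_free // => /eqP.
Qed.

Lemma dim_leD X Y U a b : subspace X -> subspace Y ->
  dim_le X Y a -> dim_le (fun x => X x /\ Y x) U b -> dim_le X U (a + b).
Proof. by move=> sX sY Xa Yb /(dim_ge_split sX sY)[]. Qed.

Lemma dim_ge_quotient X Y U n b : subspace X -> subspace Y ->
    dim_ge X U n -> dim_le (fun x => X x /\ Y x) U b ->
  dim_ge X Y (n - b).
Proof.
move=> sX sY Xn Yb; case nb: (n - b)%N => [|a].
  by exists (fun=> 0); split=> [[]|c _] //; apply/rowP; case.
have [|//|//] := @dim_ge_split X Y U a b sX sY.
by apply: dim_ge_leq Xn; lia.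
Qed.

Lemma dim_ge_subspace X Y U n a : subspace X -> subspace Y ->
    dim_ge X U n -> dim_le X Y a ->
  dim_ge (fun x => X x /\ Y x) U (n - a).
Proof.
move=> sX sY Xn Ya; case na: (n - a)%N => [|b].
  by exists (fun=> 0); split=> [[]|c _] //; apply/rowP; case.
have [|//|//] := @dim_ge_split X Y U a b sX sY.
by apply: dim_ge_leq Xn; lia.
Qed.

Lemma dim_ge1 X U : dim_ge X U 1 -> exists2 x, X x & ~ U x.
Proof.
case=> e [Xe ie]; exists (e 0) => // Ue.
have /rowP/(_ 0) : const_mx 1 = 0 :> 'rV[K]_1.
  by apply: ie; rewrite /lcomb big_ord1 mxE rmorph1 mul1r.
by rewrite !mxE => /eqP; rewrite oner_eq0.
Qed.

Lemma dim_ge_mul X U X' U' f n : (forall x, X x -> X' (f * x)) ->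
    (forall x, U' (f * x) -> U x) ->
  dim_ge X U n -> dim_ge X' U' n.
Proof.
move=> fX fU [e [Xe ie]]; exists (fun i => f * e i); split=> [i|c].
  exact/fX/Xe.
by rewrite lcomb_mul => /fU; apply: ie.
Qed.

(** Any [q.+1] vectors of ['rV_q] satisfy a nontrivial relation, which becomes a relation modulo
    [U]. *)
Lemma dim_le_form X U q (phi : A -> 'rV[K]_q) :
    (forall n c (e : 'I_n -> A),
       phi (lcomb c e) = \sum_i c 0 i *: phi (e i)) ->
    subspace X -> (forall x, X x -> phi x = 0 -> U x) ->
  dim_le X U q.
Proof.
move=> phil sX phi0 [e [Xe ie]].
pose B := \matrix_(i < q.+1) phi (e i).
have /rowV0Pn[u uB nzu] : kermx B != 0.
  by rewrite kermx_eq0 -row_leq_rank -ltnNge ltnS rank_leq_col.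
case/negP: nzu; apply/eqP; apply: ie; apply: phi0; first exact: subspace_lcomb.
rewrite phil; move/sub_kermxP: uB; rewrite mulmx_sum_row => uB0.
by rewrite -[RHS]uB0; apply: eq_bigr => i _; rewrite rowK.
Qed.

End RelativeDimension.

(** * Polynomials in two variables and their order at a point *)

Section BivariatePolynomials.
Variable K : fieldType.
Local Notation A := {poly {poly K}}.

Definition iota (c : K) : A := c%:P%:P.
HB.instance Definition _ := GRing.RMorphism.copy iota (polyC \o polyC).

(** The coordinate [x] is the inner variable ['X%:P] and [y] the outer ['X]. The substitutions
    [shift], [chi] and [rehom] are all instances, which [bipoly_morph_ext] or [bievalE] then handle
    through their values on scalars and variables. *)
Definition bieval (B : comNzRingType) (h : {rmorphism K -> B}) (u v : B) (f : A) : B :=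
  horner_eval v (map_poly (horner_eval u \o map_poly h) f).
HB.instance Definition _ (B : comNzRingType) (h : {rmorphism K -> B}) (u v : B) :=
  GRing.RMorphism.copy (bieval h u v)
    (horner_eval v \o map_poly (horner_eval u \o map_poly h)).

Arguments iota : simpl never.
Arguments bieval : simpl never.

Lemma iota0 : iota 0 = 0. Proof. exact: rmorph0. Qed.

Lemma iota1 : iota 1 = 1. Proof. exact: rmorph1. Qed.

Lemma iotaN c : iota (- c) = - iota c. Proof. exact: rmorphN. Qed.

Lemma bievalX (B : comNzRingType) (h : {rmorphism K -> B}) u v : bieval h u v ('X%:P) = u.
Proof.
by rewrite /bieval /= map_polyC /= !/(horner_eval _ _) hornerC map_polyX hornerX.
Qed.

Lemma bievalY (B : comNzRingType) (h : {rmorphism K -> B}) u v : bieval h u v 'X = v.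
Proof. by rewrite /bieval /= map_polyX /horner_eval hornerX. Qed.

Lemma bievalC (B : comNzRingType) (h : {rmorphism K -> B}) u v c : bieval h u v (iota c) = h c.
Proof.
by rewrite /bieval /iota /= map_polyC /= map_polyC !/(horner_eval _ _) !hornerC.
Qed.

Lemma bipolyE (f : A) : f = \sum_(j < size f) \sum_(i < size f`_j)
  iota f`_j`_i * 'X%:P ^+ i * 'X ^+ j.
Proof.
rewrite [LHS](_ : _ = \sum_(j < size f) (f`_j)%:P * 'X ^+ j); last first.
  rewrite -[LHS]coefK poly_def; apply: eq_bigr => j _.
  by rewrite mul_polyC.
apply: eq_bigr => j _; rewrite -mulr_suml; congr (_ * _).
rewrite -[in LHS](coefK f`_j) poly_def rmorph_sum; apply: eq_bigr => i _ /=.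
by rewrite -mul_polyC rmorphM rmorphXn.
Qed.

Lemma bievalE (B : comNzRingType) (phi : {rmorphism A -> B}) (f : A) :
  phi f = \sum_(j < size f) \sum_(i < size f`_j)
    phi (iota f`_j`_i) * phi 'X%:P ^+ i * phi 'X ^+ j.
Proof.
rewrite [in LHS](bipolyE f) rmorph_sum; apply: eq_bigr => j _.
rewrite rmorph_sum; apply: eq_bigr => i _.
by rewrite !rmorphM !rmorphXn.
Qed.

Lemma bipoly_morph_ext (B : comNzRingType) (phi psi : {rmorphism A -> B}) :
    (forall c, phi (iota c) = psi (iota c)) ->
    phi 'X%:P = psi 'X%:P -> phi 'X = psi 'X -> phi =1 psi.
Proof.
move=> eqC eqX eqY f; rewrite (bievalE phi) (bievalE psi) eqX eqY.
by apply: eq_bigr => j _; apply: eq_bigr => i _; rewrite eqC.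
Qed.

Definition shift (P : K * K) : A -> A :=
  bieval iota ('X%:P + iota P.1) ('X + iota P.2).
HB.instance Definition _ P := GRing.RMorphism.copy (shift P)
  (bieval iota ('X%:P + iota P.1) ('X + iota P.2)).

(* [chi P f] is [f(a + T, b + l T)], read in [K[l][T]], where [P = (a, b)].
   Its order in [T] is the multiplicity of [f] at [P], and its degree in [T]
   is the total degree of [f]. *)
Definition chi (P : K * K) : A -> A :=
  bieval iota ('X + iota P.1) ('X%:P * 'X + iota P.2).
HB.instance Definition _ P := GRing.RMorphism.copy (chi P)
  (bieval iota ('X + iota P.1) ('X%:P * 'X + iota P.2)).

Arguments shift : simpl never.
Arguments chi : simpl never.

Lemma chiC P c : chi P (iota c) = iota c.
Proof. exact: bievalC. Qed.

Lemma chiX P : chi P 'X%:P = 'X + iota P.1.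
Proof. exact: bievalX. Qed.

Lemma chiY P : chi P 'X = 'X%:P * 'X + iota P.2.
Proof. exact: bievalY. Qed.

Lemma chi_subX P c : chi P ('X%:P - iota c) = 'X + iota (P.1 - c).
Proof. by rewrite (rmorphB (chi P)) /= chiX chiC (rmorphB iota) /= addrA. Qed.

Lemma chi_subY P c : chi P ('X - iota c) = 'X%:P * 'X + iota (P.2 - c).
Proof. by rewrite (rmorphB (chi P)) /= chiY chiC (rmorphB iota) /= addrA. Qed.

Lemma shiftC P c : shift P (iota c) = iota c.
Proof. exact: bievalC. Qed.

Lemma shiftX P : shift P 'X%:P = 'X%:P + iota P.1.
Proof. exact: bievalX. Qed.

Lemma shiftY P : shift P 'X = 'X + iota P.2.
Proof. exact: bievalY. Qed.

Lemma chi_shift P f : chi P f = chi (0, 0) (shift P f).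
Proof.
apply: (@bipoly_morph_ext _ (chi P) (chi (0, 0) \o shift P)) => [c||] /=.
- by rewrite shiftC !chiC.
- by rewrite shiftX rmorphD /= !chiX chiC /= rmorph0 addr0.
by rewrite shiftY rmorphD /= !chiY chiC /= rmorph0 addr0.
Qed.

Lemma shiftK a b f : shift (- a, - b) (shift (a, b) f) = f.
Proof.
apply: (@bipoly_morph_ext _ (shift (- a, - b) \o shift (a, b)) idfun) => [c||] /=.
- by rewrite !shiftC.
- by rewrite shiftX rmorphD /= shiftX shiftC /= !rmorphN addrNK.
by rewrite shiftY rmorphD /= shiftY shiftC /= !rmorphN addrNK.
Qed.

Lemma shiftE P (f : A) : shift P f = \sum_(j < size f) \sum_(i < size f`_j)
  iota f`_j`_i * ('X%:P + iota P.1) ^+ i * ('X + iota P.2) ^+ j.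
Proof.
rewrite (@bievalE A (shift P)); apply: eq_bigr => j _; apply: eq_bigr => i _ /=.
by rewrite shiftC shiftX shiftY.
Qed.

Lemma coef_iotaM c (f : A) j : (iota c * f)`_j = c%:P * f`_j.
Proof. by rewrite coefCM. Qed.

Lemma coef2_iotaM c (f : A) j i : (iota c * f)`_j`_i = c * f`_j`_i.
Proof. by rewrite !coefCM. Qed.

(** At the origin the coefficient of [T^n] is the homogeneous component of degree [n], written in
    the slope [l = y / x]. *)
Lemma coef_chi0 (f : A) n j :
  (chi (0, 0) f)`_n`_j = if (j <= n)%N then f`_j`_(n - j) else 0.
Proof.
rewrite bievalE /= chiX chiY /= !rmorph0 !addr0.
transitivity (\sum_(l < size f) \sum_(i < size f`_l)
    if (j == l) && (n == i + l)%N then f`_l`_i else 0).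
  rewrite coef_sum coef_sum; apply: eq_bigr => l _.
  rewrite coef_sum coef_sum; apply: eq_bigr => i _.
  rewrite chiC exprMn mulrCA -mulrA -exprD mulrCA coef2_iotaM.
  rewrite -rmorphXn /= coefCM !coefXn addnC; case: eqP => _; last first.
    by rewrite mulr0 coef0 mulr0 andbF.
  by rewrite mulr1 coefXn andbT; case: eqP => _; rewrite ?mulr1 ?mulr0.
case: leqP => [le_jn|lt_nj]; last first.
  apply: big1 => l _; apply: big1 => i _; case: eqP => //= def_j.
  by case: eqP => // def_n; move: lt_nj; rewrite def_n def_j ltnNge leq_addl.
have [lt_j|ge_j] := ltnP j (size f); last first.
  rewrite [in RHS](nth_default _ ge_j) coef0; apply: big1 => l _; apply: big1 => i _.
  by case: eqP => //= def_j; move: ge_j; rewrite def_j leqNgt ltn_ord.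
rewrite (bigD1 (Ordinal lt_j)) //= [X in _ + X]big1 ?addr0 => [|l]; last first.
  move=> /eqP ne_l; apply: big1 => i _; case: eqP => //= def_j.
  by case: ne_l; apply: val_inj.
have [lt_i|ge_i] := ltnP (n - j) (size f`_j); last first.
  rewrite [in RHS](nth_default _ ge_i); apply: big1 => i _.
  rewrite eqxx /=; case: eqP => // def_n.
  by move: ge_i; rewrite def_n addnK leqNgt ltn_ord.
rewrite (bigD1 (Ordinal lt_i)) //= [X in _ + X]big1 ?addr0 => [|i].
  by rewrite subnK // !eqxx.
move=> /eqP ne_i; rewrite eqxx /=; case: eqP => // def_n.
by case: ne_i; apply: val_inj; rewrite /= def_n addnK.
Qed.

(** Each [l] comes with a factor [T]; hence killing the coefficient of [T^n] amounts to [n + 1]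
    scalar conditions. *)
Lemma coef_chi_big P (f : A) n j : (n < j)%N -> (chi P f)`_n`_j = 0.
Proof. by move=> ltnj; rewrite chi_shift coef_chi0 leqNgt ltnj. Qed.

Lemma chi0_inj (f : A) : chi (0, 0) f = 0 -> f = 0.
Proof.
move=> f0; apply/polyP => j; rewrite coef0; apply/polyP => i; rewrite coef0.
by have := coef_chi0 f (i + j) j; rewrite f0 !coef0 leq_addl addnK => <-.
Qed.

Lemma chi_eq0 P (f : A) : (chi P f == 0) = (f == 0).
Proof.
apply/eqP/eqP => [|->]; last exact: rmorph0.
rewrite chi_shift => /chi0_inj sf0.
by case: P sf0 => a b sf0; rewrite -[f](shiftK a b) sf0 rmorph0.
Qed.

Definition ord_ge P k (f : A) := forall n, (n < k)%N -> (chi P f)`_n = 0.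

(** The zero polynomial gets multiplicity 0 here, although it satisfies [ord_ge] for every order;
    hence the condition [f != 0] in [ord_geP]. *)
Definition mult P (f : A) := find (fun c => c != 0) (chi P f : seq _).

Lemma ord_ge_mult P (f : A) : ord_ge P (mult P f) f.
Proof. by move=> n ltn; apply/eqP; have := before_find 0 ltn; move/negbT; rewrite negbK. Qed.

Lemma mult_nz P (f : A) : f != 0 -> (chi P f)`_(mult P f) != 0.
Proof.
move=> nzf; apply: (nth_find 0 (a := fun c => c != 0)).
apply/hasP; exists (lead_coef (chi P f)); last by rewrite lead_coef_eq0 chi_eq0.
by rewrite lead_coefE mem_nth // prednK // lt0n size_poly_eq0 chi_eq0.
Qed.

Lemma ord_geP P k (f : A) : f != 0 -> ord_ge P k f <-> (k <= mult P f)%N.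
Proof.
move=> nzf; split=> [of_|lek n ltn]; last first.
  by apply: (@ord_ge_mult P); apply: leq_trans lek.
rewrite leqNgt; apply/negP => /of_ m0.
by have := mult_nz P nzf; rewrite m0 eqxx.
Qed.

Lemma ord_geW P k l (f : A) : (k <= l)%N -> ord_ge P l f -> ord_ge P k f.
Proof. by move=> lekl of_ n ltn; apply: of_; apply: leq_trans lekl. Qed.

Lemma ord_ge0 P (f : A) : ord_ge P 0 f.
Proof. by []. Qed.

Lemma ord_geM P k l (f h : A) : ord_ge P k f -> ord_ge P l h -> ord_ge P (k + l) (f * h).
Proof.
move=> of_ oh n ltn; rewrite rmorphM /= coefM big1 // => i _.
have [ltik|leki] := ltnP i k; first by rewrite of_ // mul0r.
by rewrite oh ?mulr0 //; move: (ltn_ord i); lia.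
Qed.

Lemma ord_geMl P k (f h : A) : ord_ge P k h -> ord_ge P k (f * h).
Proof. exact: (@ord_geM P 0). Qed.

Lemma ord_geX P k n (f : A) : ord_ge P k f -> ord_ge P (n * k) (f ^+ n).
Proof.
move=> of_; elim: n => [|n IHn] //; rewrite mulSn exprS; exact: ord_geM.
Qed.

(** The lowest coefficient of [chi P f] is nonzero in a domain. By induction on [n], the coefficient
    of index [mult P f + n] in the product is that element times the coefficient of index [n] of
    [chi P h]. *)
Lemma ord_ge_divl P s (f h : A) : f != 0 -> ord_ge P s (f * h) ->
  ord_ge P (s - mult P f) h.
Proof.
move=> nzf ofh n; elim/ltn_ind: n => n IHn ltn.
have ltmn : (mult P f + n < s)%N by lia.
have := ofh _ ltmn; rewrite rmorphM /= coefM.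
rewrite (bigD1 (inord (mult P f))) //= inordK ?ltnS ?leq_addr //.
rewrite addKn big1 => [|i ne_i]; last first.
  have [lti|gei] := ltnP i (mult P f); first by rewrite ord_ge_mult ?mul0r.
  have ne : mult P f != i :> nat.
    apply: contra ne_i => /eqP e; apply/eqP/val_inj.
    by rewrite /= inordK ?e // ltnS leq_addr.
  have lei := ltn_ord i.
  by rewrite IHn ?mulr0 //; lia.
by rewrite addr0 => /eqP; rewrite mulf_eq0 (negPf (mult_nz P nzf)) /= => /eqP.
Qed.

Lemma subspace_ord_ge P k : subspace iota (ord_ge P k).
Proof.
split=> [n _|c f h of_ oh n ltn]; first by rewrite rmorph0 coef0.
by rewrite rmorphD /= rmorphM /= chiC coefD coef_iotaM of_ // oh // mulr0 addr0.
Qed.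

Lemma subspaceI (U V : A -> Prop) : subspace iota U -> subspace iota V ->
  subspace iota (fun f => U f /\ V f).
Proof.
move=> [U0 Us] [V0 Vs]; split=> // c f h [Uf Vf] [Uh Vh].
by split; [apply: Us|apply: Vs].
Qed.

Lemma chi_lcomb P m c (e : 'I_m -> A) n j :
  (chi P (lcomb iota c e))`_n`_j = \sum_i c 0 i * (chi P (e i))`_n`_j.
Proof.
rewrite rmorph_sum /= coef_sum coef_sum; apply: eq_bigr => i _.
by rewrite rmorphM /= chiC coef2_iotaM.
Qed.

Definition monom_at (P : K * K) n j : A :=
  ('X%:P - iota P.1) ^+ (n - j) * ('X - iota P.2) ^+ j.

Lemma chi_monom_at P n j : (j <= n)%N -> chi P (monom_at P n j) = ('X^j)%:P * 'X^n.
Proof.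
move=> le_jn; rewrite /monom_at rmorphM /= !rmorphXn /= !rmorphB /= !chiX !chiY !chiC.
by rewrite !addrK exprMn mulrCA -exprD subnK // rmorphXn.
Qed.

End BivariatePolynomials.

(** * Counting the conditions imposed by order and by degree *)

Section OrderDimension.
Variable K : fieldType.
Local Notation A := {poly {poly K}}.
Local Notation io := (@iota K).
Local Notation dimge := (@dim_ge K A (@iota K)).
Local Notation dimle := (@dim_le K A (@iota K)).
Local Notation subsp := (@subspace K A (@iota K)).

(** The number of conditions for order [s] at a point; [tri t.+1] is also the dimension of the
    polynomials of degree at most [t]. *)
Definition tri s := 'C(s.+1, 2).

Lemma triS s : tri s.+1 = (tri s + s.+1)%N.
Proof. by rewrite /tri binS bin1 addnC. Qed.

Lemma tri_double s : (tri s * 2 = s * s.+1)%N.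
Proof. by elim: s => // s IHs; rewrite triS; lia. Qed.

(** Passing from order [s] to [s.+1] costs the [s.+1] coefficients of the initial form of degree
    [s]. *)
Lemma codim_ord_ge_le P s : dimle (fun=> True) (@ord_ge K P s) (tri s).
Proof.
elim: s => [|s IHs].
  by move/dim_ge1 => [f _]; apply; apply: ord_ge0.
rewrite triS; apply: dim_leD IHs _ => //; first exact: subspace_ord_ge.
apply: (@dim_le_form _ _ _ _ _ _ (fun f => \row_(j < s.+1) (chi P f)`_s`_j)).
- move=> n c e; apply/rowP => j; rewrite summxE mxE chi_lcomb.
  by apply: eq_bigr => i _; rewrite !mxE.
- apply: subspaceI => //; exact: subspace_ord_ge.
move=> f [_ of_] /rowP f0 n; rewrite ltnS leq_eqVlt => /orP[/eqP->|]; last exact: of_.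
apply/polyP => j; rewrite coef0; have [lts|ge] := ltnP s j; first exact: coef_chi_big.
by have := f0 (inord j); rewrite !mxE inordK.
Qed.

(** Monomials centred at [P] of degree below [s] are independent modulo order [s]. The space [D] is
    left free so that the count serves for all polynomials and for those of bounded degree. *)
Lemma codim_ord_ge_ge P s (D : A -> Prop) : subsp D ->
    (forall n j, (n < s)%N -> (j <= n)%N -> D (monom_at P n j)) ->
  dimge D (@ord_ge K P s) (tri s).
Proof.
move=> sD; elim: s => [|s IHs] Dm.
  by exists (fun=> 0); split=> [[]|c _] //; apply/rowP; case.
have sDs := subspaceI sD (subspace_ord_ge P s).
suff: dimge D (fun f => D f /\ ord_ge P s.+1 f) (tri s.+1).
  by apply: dim_ge_mod.
rewrite triS; apply: (dim_geD sDs) => [f [Df of_]|f []||] //.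
- by split=> //; apply: ord_geW of_.
- suff: dimge D (@ord_ge K P s) (tri s) by apply: dim_ge_sub => // f [].
  by apply: IHs => n j lt_n; apply: Dm; apply: ltnW.
exists (fun j : 'I_s.+1 => monom_at P s j); split=> [j|c [_ Uc]].
  have lej : (j <= s)%N by rewrite -ltnS.
  split; first exact: Dm.
  by move=> n ltn; rewrite chi_monom_at // coefCM coefXn (ltn_eqF ltn) mulr0.
apply/rowP => j; rewrite mxE; have := Uc s (ltnSn s) => /polyP/(_ j).
rewrite coef0 chi_lcomb (bigD1 j) //= big1 => [|i ne_i].
  rewrite chi_monom_at -1?ltnS // coefCM coefXn eqxx mulr1 coefXn eqxx mulr1.
  by rewrite addr0.
rewrite chi_monom_at -1?ltnS // coefCM coefXn eqxx mulr1 coefXn eq_sym.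
by rewrite (negPf ne_i : (i == j :> nat) = false) mulr0.
Qed.

Definition deg_le t (f : A) : Prop := (size (chi (0%R, 0%R) f) <= t.+1)%N.

Lemma subspace_deg_le t : subsp (deg_le t).
Proof.
rewrite /deg_le; split=> [|c f h df dh]; first by rewrite rmorph0 size_poly0.
rewrite rmorphD /= rmorphM /= chiC (leq_trans (size_polyD _ _)) // geq_max dh andbT.
by rewrite /= mul_polyC (leq_trans (size_scale_leq _ _)).
Qed.

Lemma deg_leM t t' f h : deg_le t f -> deg_le t' h -> deg_le (t + t') (f * h).
Proof.
rewrite /deg_le rmorphM /= => df dh; apply: leq_trans (size_polyMleq _ _) _.
by move: df dh; set a := size _; set b := size _; lia.
Qed.

Lemma deg_leW t t' f : (t <= t')%N -> deg_le t f -> deg_le t' f.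
Proof. by move=> lett df; apply: leq_trans df _. Qed.

Lemma deg_le_iota c : deg_le 0 (io c).
Proof. by rewrite /deg_le chiC size_polyC_leq1. Qed.

Lemma deg_leX : deg_le 1 'X%:P.
Proof. by rewrite /deg_le chiX /= rmorph0 addr0 size_polyX. Qed.

Lemma deg_leY : deg_le 1 'X.
Proof.
rewrite /deg_le chiY /= rmorph0 addr0 mul_polyC.
by apply: leq_trans (size_scale_leq _ _) _; rewrite size_polyX.
Qed.

Lemma deg_leXn t n f : deg_le t f -> deg_le (n * t) (f ^+ n).
Proof.
move=> df; elim: n => [|n IHn]; last by rewrite mulSn exprS; apply: deg_leM.
by rewrite expr0 -(rmorph1 io); apply: deg_le_iota.
Qed.

Lemma deg_leN t f : deg_le t f -> deg_le t (- f).
Proof.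
move=> df; rewrite -sub0r; have sd := subspace_deg_le t.
by apply: (subspaceB sd) => //; case: sd.
Qed.

Lemma deg_leD t f h : deg_le t f -> deg_le t h -> deg_le t (f + h).
Proof. exact: (subspaceD (subspace_deg_le t)). Qed.

Lemma deg_le_monom_at P n j : (j <= n)%N -> deg_le n (monom_at P n j).
Proof.
move=> lejn; rewrite -{1}(subnK lejn) /monom_at; apply: deg_leM.
  rewrite -[X in deg_le X]muln1; apply/deg_leXn/deg_leD; first exact: deg_leX.
  by apply/deg_leN/(@deg_leW 0) => //; apply: deg_le_iota.
rewrite -[X in deg_le X]muln1; apply/deg_leXn/deg_leD; first exact: deg_leY.
by apply/deg_leN/(@deg_leW 0) => //; apply: deg_le_iota.
Qed.

Lemma deg_le_exn n (e : 'I_n -> A) : exists t, forall i, deg_le t (e i).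
Proof.
exists (\max_i size (chi (0%R, 0%R) (e i))) => i; apply/leqW.
exact: (leq_bigmax_cond (F := fun i => size (chi (0, 0) (e i)))).
Qed.

Lemma deg_le_coef t f : deg_le t f -> forall i j, (t < i + j)%N -> f`_j`_i = 0.
Proof.
move=> df i j lt; have := coef_chi0 f (i + j) j; rewrite leq_addl addnK => <-.
by rewrite (nth_default _ (leq_trans df lt)) coef0.
Qed.

Lemma dim_deg_le_ge t : dimge (deg_le t) (eq^~ 0) (tri t.+1).
Proof.
have: dimge (deg_le t) (@ord_ge K (0, 0) t.+1) (tri t.+1).
  apply: codim_ord_ge_ge; first exact: subspace_deg_le.
  by move=> n j ltn lejn; apply: deg_leW (deg_le_monom_at _ lejn).
apply: dim_ge_mod => [|f _ ->]; first exact: subspace_deg_le.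
by case: (subspace_ord_ge (0 : K, 0 : K) t.+1).
Qed.

(** Degree at most [t] and order above [t] at the origin force zero, so the number of conditions for
    order [t.+1] bounds this dimension. *)
Lemma dim_deg_le_le t : dimle (deg_le t) (eq^~ 0) (tri t.+1).
Proof.
move=> dt; apply: (@codim_ord_ge_le (0, 0) t.+1).
suff: dimge (deg_le t) (@ord_ge K (0, 0) t.+1) (tri t.+1).+1.
  by apply: dim_ge_sub.
apply: dim_ge_mod dt => [|f df of_]; first exact: subspace_deg_le.
apply: chi0_inj; apply/polyP => n; rewrite coef0.
by have [/of_//|ge] := ltnP n t.+1; rewrite nth_default // (leq_trans df).
Qed.

Definition ord_space (L : seq (K * K)) (s : K * K -> nat) (f : A) :=
  forall P, P \in L -> ord_ge P (s P) f.

Lemma subspace_ord_space L s : subsp (ord_space L s).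
Proof.
split=> [P _|c f h of_ oh P LP]; case: (subspace_ord_ge P (s P)) => // _; apply; auto.
Qed.

Lemma codim_ord_space_le L s :
  dimle (fun=> True) (ord_space L s) (\sum_(P <- L) tri (s P)).
Proof.
elim: L => [|P L IHL].
  by rewrite big_nil => /dim_ge1[f _]; apply.
rewrite big_cons addnC; apply: dim_leD IHL _ => //; first exact: subspace_ord_space.
move=> dPL; apply: (@codim_ord_ge_le P (s P)).
suff: dimge (fun x => True /\ ord_space L s x) (@ord_ge K P (s P)) (tri (s P)).+1.
  by apply: dim_ge_sub.
apply: dim_ge_mod dPL; first by apply: subspaceI => //; apply: subspace_ord_space.
by move=> f [_ oL] oP Q; rewrite inE => /orP[/eqP->|/oL].
Qed.

(** A product of powers of lines [x - a'] or [y - b'], one for each point of [L], chosen by a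
    coordinate in which that point differs from [P]. *)
Lemma separating_poly L s (P : K * K) : P \notin L ->
  exists2 u : A, ord_space L s u & (chi P u)`_0 != 0.
Proof.
suff sep (Q : K * K) : P != Q -> exists2 l : A, ord_ge Q 1 l & (chi P l)`_0 != 0.
  elim: L => [|Q L IHL]; first by exists 1 => //; rewrite rmorph1 coef1 oner_eq0.
  rewrite inE negb_or => /andP[/sep[l olQ nzl] /IHL[u ou nzu]].
  exists (l ^+ s Q * u) => [Q'|].
    rewrite inE => /orP[/eqP->|LQ']; last exact/ord_geMl/ou.
    by rewrite mulrC; apply: ord_geMl; rewrite -[X in ord_ge _ X]muln1; apply: ord_geX.
  rewrite rmorphM /= rmorphXn /= -horner_coef0 hornerM horner_exp !horner_coef0.
  by rewrite mulf_neq0 // expf_neq0.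
case: P Q => a b [a' b']; rewrite xpair_eqE negb_and => /orP[ne|ne].
  exists ('X%:P - io a').
    by case=> // _; rewrite chi_subX /= subrr rmorph0 addr0 coefX.
  by rewrite chi_subX coefD coefX add0r coefC polyC_eq0 subr_eq0.
exists ('X - io b').
  by case=> // _; rewrite chi_subY /= subrr rmorph0 addr0 coefMX.
by rewrite chi_subY coefD coefMX add0r coefC polyC_eq0 subr_eq0.
Qed.

(** Conditions at distinct points are independent: multiplication by a separating [u] lands in
    [ord_space L s] and, [u] being nonzero at [P], leaves orders at [P] unchanged. *)
Lemma codim_ord_space_ge L s : uniq L ->
  dimge (fun=> True) (ord_space L s) (\sum_(P <- L) tri (s P)).
Proof.
elim: L => [_|P L IHL /= /andP[nLP uL]].
  by rewrite big_nil; exists (fun=> 0); split=> // c _; apply/rowP; case.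
rewrite big_cons addnC.
have sL := subspace_ord_space L s.
apply: (dim_geD sL _ _ (IHL uL)) => // [f oPL Q LQ|].
  by apply: oPL; rewrite inE LQ orbT.
have [u ou nzu0] := separating_poly s nLP.
have nzu : u != 0 by apply: contraNneq nzu0 => ->; rewrite rmorph0 coef0.
have mu : mult P u = 0%N.
  apply/eqP; rewrite -leqn0 leqNgt; apply/negP => /ord_ge_mult m0.
  by rewrite m0 eqxx in nzu0.
have : dimge (fun=> True) (@ord_ge K P (s P)) (tri (s P)) by apply: codim_ord_ge_ge.
apply: (@dim_ge_mul _ _ _ _ _ _ _ u) => f.
  by move=> _ Q LQ; rewrite mulrC; apply/ord_geMl/ou.
by move/(_ P (mem_head _ _))/(ord_ge_divl nzu); rewrite mu subn0.
Qed.

End OrderDimension.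

(** * Irreducible polynomials in two variables: primality and zeros *)

Section ClosedField.
Variable K : closedFieldType.
Local Notation A := {poly {poly K}}.

Definition divides (G f : A) := exists h, f = G * h.

Definition bconst (f : A) := exists k, f = iota k.

Definition birreducible (G : A) :=
  ~ bconst G /\ forall a b, G = a * b -> bconst a \/ bconst b.

Definition bprime (G : A) :=
  ~ divides G 1 /\ forall a b, divides G (a * b) -> divides G a \/ divides G b.

Definition fiber (a : K) : A -> {poly K} := map_poly (horner_eval a).
HB.instance Definition _ a := GRing.RMorphism.copy (fiber a) (map_poly (horner_eval a)).
Arguments fiber : simpl never.

Lemma fiberC a c : fiber a c%:P = (c.[a])%:P.
Proof. by rewrite /fiber map_polyC. Qed.

Lemma fiber_iota a k : fiber a (iota k) = k%:P.
Proof. by rewrite /iota fiberC hornerC. Qed.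

Lemma fiber_affine a b l k (q : A) :
  (fiber a (iota l * q - iota k)).[b] = l * (fiber a q).[b] - k.
Proof.
rewrite (rmorphB (fiber a)) (rmorphM (fiber a)) /= !fiber_iota.
by rewrite hornerD hornerN hornerCM hornerC.
Qed.

Lemma fiber0_divides a f : fiber a f = 0 -> divides ('X - a%:P)%:P f.
Proof.
move=> f0; exists (map_poly (fun c => c %/ ('X - a%:P)) f).
apply/polyP => j; rewrite coefCM coef_map_id0 ?div0p // mulrC divpK //.
rewrite dvdp_XsubCl; apply/rootP; move/polyP/(_ j): f0.
by rewrite coef0 coef_map.
Qed.

Lemma nonconst_root (p : {poly K}) : (1 < size p)%N -> exists r, root p r.
Proof. by move=> sp; apply/closed_rootP; case: (size p) sp => [|[]]. Qed.

(** Gauss's lemma. At a root [a] of [c] the product [d * e] vanishes on the line [x = a], so one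
    factor does and [x - a] can be cancelled from it; [c] splits because [K] is closed. *)
Lemma cancel_content (c : {poly K}) (f d e : A) : c != 0 -> c%:P * f = d * e ->
  exists d' e' (c1 c2 : {poly K}), [/\ f = d' * e', d = c1%:P * d' & e = c2%:P * e'].
Proof.
have [n] := ubnP (size c); elim: n => // n IHn in c d e * => le_c nzc def_cf.
have [le1|gt1] := leqP (size c) 1.
  have /size_poly1P[k nzk def_c] : size c == 1%N.
    by rewrite eqn_leq le1 lt0n size_poly_eq0.
  have kK : iota k * iota k^-1 = 1 :> A by rewrite -rmorphM /= mulfV // rmorph1.
  exists (iota k^-1 * d), e, k%:P, 1; split; rewrite ?mul1r //.
    rewrite -mulrA -def_cf def_c -[_%:P%:P]/(iota k) mulrA.
    by rewrite [iota _ * _]mulrC kK mul1r.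
  by rewrite mulrA -[_%:P%:P]/(iota k) kK mul1r.
have [a /factor_theorem[c' def_c]] := nonconst_root gt1.
have nzX : ('X - a%:P)%:P != 0 :> A by rewrite polyC_eq0 polyXsubC_eq0.
have nzc' : c' != 0 by apply: contraNneq nzc => c'0; rewrite def_c c'0 mul0r.
have lt_c' : (size c' < n)%N.
  by move: le_c; rewrite def_c size_Mmonic ?monicXsubC // size_XsubC addn2 ltnS.
have : fiber a d * fiber a e = 0.
  rewrite -(rmorphM (fiber a)) /= -def_cf (rmorphM (fiber a)) /= fiberC def_c.
  by rewrite hornerM hornerXsubC subrr mulr0 mul0r.
move/eqP; rewrite mulf_eq0 => /orP[]/eqP/fiber0_divides[q def_q].
  have [|d' [e' [c1 [c2 [-> def_d' def_e']]]]] := IHn c' q e lt_c' nzc'.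
    apply: (mulfI nzX); rewrite mulrA -polyCM [_ * c']mulrC -def_c.
    by rewrite def_cf def_q; ring.
  exists d', e', (('X - a%:P) * c1), c2; split=> //.
  by rewrite def_q def_d' polyCM mulrA.
have [|d' [e' [c1 [c2 [-> def_d' def_e']]]]] := IHn c' d q lt_c' nzc'.
  apply: (mulfI nzX); rewrite mulrA -polyCM [_ * c']mulrC -def_c.
    by rewrite def_cf def_q; ring.
exists d', e', c1, (('X - a%:P) * c2); split=> //.
by rewrite def_q def_e' polyCM mulrA.
Qed.


Lemma birreducible_polyC (G : A) c : birreducible G -> G = c%:P ->
  exists k a, k != 0 /\ G = iota k * ('X - a%:P)%:P.
Proof.
case=> nG irG def_G; have sc : (1 < size c)%N.
  rewrite ltnNge; apply/negP => /size1_polyC def_c.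
  by case: nG; exists c`_0; rewrite def_G [in LHS]def_c.
have [a /factor_theorem[c' def_c]] := nonconst_root sc.
have [|[k def_k]|[k def_k]] := irG c'%:P ('X - a%:P)%:P.
- by rewrite def_G def_c polyCM.
- exists k, a; split.
    apply: contraPneq nG => k0 []; exists 0.
    by rewrite def_G def_c polyCM def_k k0 !rmorph0 mul0r.
  by rewrite def_G def_c polyCM def_k.
move: (congr1 (fun p : A => size p`_0) def_k); rewrite !coefC eqxx size_XsubC.
by case: size (size_polyC_leq1 k) => [|[]].
Qed.

(** Divisibility by [G] may be tested with coefficients rational in [x]: the content cancelled from
    [G] is constant by irreducibility. *)
Lemma pseudo_divides (G f q : A) (c : {poly K}) : birreducible G ->
  (1 < size G)%N -> c != 0 -> c%:P * f = q * G -> divides G f.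
Proof.
move=> [nG irG] sG nzc /(cancel_content nzc)[q' [G' [c1 [c2 [-> _ def_G]]]]].
have [[k def_c]|[k def_G']] := irG _ _ def_G; last first.
  move: sG; rewrite def_G def_G' -polyCM ltnNge.
  by rewrite size_polyC_leq1.
have nzk : k != 0.
  by apply: contraPneq nG => k0 []; exists 0; rewrite def_G def_c k0 !rmorph0 mul0r.
exists (iota k^-1 * q'); rewrite def_G def_c mulrACA -rmorphM /= mulfV // rmorph1.
by rewrite mul1r mulrC.
Qed.

Lemma birreducible_neq0 G : birreducible G -> G != 0.
Proof. by case=> nG _; apply: contraPneq nG => -> []; exists 0; rewrite rmorph0. Qed.

(** If [G] involves [x] alone it is a vertical line, and divisibility means vanishing on it.
    Otherwise consider the gcd of [G] and [a] over [K(x)]: it is [G] up to a factor in [x], and [G]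
    divides [a], or it is free of [y], and coprimality makes [G] divide [b]. *)
Lemma birreducible_prime (G : A) : birreducible G -> bprime G.
Proof.
move=> irG; have nzG := birreducible_neq0 irG; split.
  case=> h def_1; case: irG => nG _; apply: nG.
  have /unitrPr : exists h, G * h = 1 by exists h.
  rewrite poly_unitE => /andP[/eqP/eq_leq/size1_polyC def_G uG0].
  move: uG0; rewrite poly_unitE => /andP[/eqP/eq_leq/size1_polyC def_G0 _].
  by exists G`_0`_0; rewrite {1}def_G {1}def_G0.
move=> a b [q def_ab].
have [sG|/size1_polyC def_G] := ltnP 1 (size G); last first.
  have [k [r [nzk def_G']]] := birreducible_polyC irG def_G; rewrite def_G'.
  have kK : iota k * iota k^-1 = 1 :> A by rewrite -rmorphM /= mulfV // rmorph1.
  have dv f : fiber r f = 0 -> divides (iota k * ('X - r%:P)%:P) f.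
    case/fiber0_divides=> h ->; exists (iota k^-1 * h).
    by rewrite mulrACA kK mul1r.
  have : fiber r a * fiber r b = 0.
    rewrite -(rmorphM (fiber r)) /= def_ab def_G' !(rmorphM (fiber r)) /=.
    by rewrite [fiber r ('X - r%:P)%:P]fiberC hornerXsubC subrr mulr0 mul0r.
  by move/eqP; rewrite mulf_eq0 => /orP[]/eqP/dv; [left|right].
set d := gcdp G a.
have /Pdiv.Idomain.dvdpP[[c e] /= nzc] := dvdp_gcdl G a.
rewrite -mul_polyC -/d => /(cancel_content nzc)[e' [d' [c1 [c2 [def_G _ def_d]]]]].
have [[k def_e']|[k def_d']] := irG.2 _ _ def_G.
  left; have /Pdiv.Idomain.dvdpP[[l h] /= nzl] := dvdp_gcdr G a.
  rewrite -mul_polyC -/d => def_la.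
  have nzk : k != 0 by apply: contraNneq nzG => k0; rewrite def_G def_e' k0 rmorph0 mul0r.
  apply: (pseudo_divides (q := h * c2%:P * iota k^-1) irG sG nzl).
  rewrite def_la def_d def_G def_e' -[RHS]mulrA [iota k^-1 * _]mulrA -rmorphM /= mulVf //.
  by rewrite rmorph1 mul1r mulrA.
right; have nzd : d != 0 by rewrite gcdp_eq0 (negPf nzG).
have co : coprimep G a.
  rewrite coprimep_def -/d eqn_leq lt0n size_poly_eq0 nzd andbT.
  by rewrite def_d def_d' -polyCM size_polyC_leq1.
have : G %| a * b.
  by apply/Pdiv.Idomain.dvdpP; exists (1, q) => /=; rewrite ?oner_eq0 // scale1r def_ab mulrC.
rewrite Gauss_dvdpr // => /Pdiv.Idomain.dvdpP[[l h] /= nzl].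
by rewrite -mul_polyC; apply: pseudo_divides.
Qed.

(** A closed field is infinite: a root of [p * 'X + 1] cannot be a root of [p]. *)
Lemma exists_notin (s : seq K) (l : {poly K}) : l != 0 ->
  exists2 a, a \notin s & l.[a] != 0.
Proof.
move=> nzl; pose p := (\prod_(z <- s) ('X - z%:P)) * l.
have nzp : p != 0.
  by rewrite mulf_neq0 // prodf_seq_neq0; apply/allP => z _; rewrite polyXsubC_eq0.
have [|r] := @nonconst_root (p * 'X + 1).
  by rewrite size_MXaddC (negPf nzp) /= ltnS size_poly_gt0.
rewrite /root hornerD hornerMX hornerC => /eqP e.
have nzr : p.[r] != 0.
  by apply: contra_eqN e => /eqP->; rewrite mul0r add0r oner_eq0.
move: nzr; rewrite hornerM mulf_eq0 negb_or => /andP[nzs nzlr].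
by exists r => //; apply: contra nzs; rewrite -[_ == 0]/(root _ _) root_prod_XsubC.
Qed.

Lemma chi_coef0 P (f : A) : (chi P f)`_0 = ((fiber P.1 f).[P.2])%:P.
Proof.
pose ev := horner_eval P.2 \o fiber P.1.
rewrite -horner_coef0.
apply: (@bipoly_morph_ext _ _ (horner_eval 0 \o chi P) (polyC \o ev)) => [c||] /=.
- by rewrite chiC /horner_eval /iota fiberC !hornerC.
- by rewrite chiX /horner_eval /iota fiberC hornerD !hornerC !hornerX add0r.
- rewrite chiY /horner_eval /iota /fiber map_polyX hornerD hornerM.
  by rewrite !hornerC !hornerX mulr0 add0r.
Qed.

(** On a vertical line that avoids the abscissas of [L] and the zeros of the leading coefficient in
    [y], the restriction of [G] keeps its degree and has a root. A [G] in [x] alone is itself a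
    vertical line, on which any new ordinate will do. *)
Lemma curve_point_notin (G : A) (L : seq (K * K)) : birreducible G ->
  exists2 P, P \notin L & ord_ge P 1 G.
Proof.
move=> irG; have nzG := birreducible_neq0 irG.
suff [[a b] nL G0] : exists2 P, P \notin L & (fiber P.1 G).[P.2] = 0.
  by exists (a, b) => // -[] // _; rewrite chi_coef0 G0.
have [sG|/size1_polyC def_G] := ltnP 1 (size G); last first.
  have [k [a [_ ->]]] := birreducible_polyC irG def_G.
  have [b nb _] := exists_notin (unzip2 L) (oner_neq0 {poly K}).
  exists (a, b); first by apply: contra nb => Lab; apply/mapP; exists (a, b).
  rewrite /= (rmorphM (fiber a)) /= [fiber a ('X - a%:P)%:P]fiberC.
  by rewrite hornerXsubC subrr mulr0 hornerC.
have nzl : lead_coef G != 0 by rewrite lead_coef_eq0.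
have [a na la] := exists_notin (unzip1 L) nzl.
have [|b /rootP rb] := @nonconst_root (fiber a G).
  by rewrite /fiber size_map_poly_id0.
by exists (a, b) => //; apply: contra na => Lab; apply/mapP; exists (a, b).
Qed.

End ClosedField.

(** * Identities between triangular numbers *)

Lemma tri_gt0 s : (0 < tri s)%N = (0 < s)%N.
Proof. by rewrite /tri bin_gt0. Qed.

Lemma leq_tri s t : (s <= t)%N -> (tri s <= tri t)%N.
Proof. by move=> lest; apply: leq_bin2l; rewrite ltnS. Qed.

(** The truncated [s - m] is harmless up to [m = s.+1], where the two summands are both [tri s]. *)
Lemma tri_sub m s : (m <= s.+1)%N ->
  (tri s - tri (s - m) + tri m.-1 = m * s)%N.
Proof.
have := tri_double s; have := tri_double (s - m); have := tri_double m.-1.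
have := leq_tri (leq_subr m s); case: m => [|m] /=; first by rewrite subn0; lia.
rewrite ltnS => le_tri d1 d2 d3 le_ms.
have [le|gt] := leqP m.+1 s; last first.
  have e : m = s by lia.
  by move: d1 d2 d3 le_tri; rewrite e (_ : s - s.+1 = 0)%N; nia.
have [q def_s] : exists q, s = (m.+1 + q)%N by exists (s - m.+1)%N; lia.
by move: d1 d2 d3 le_tri; rewrite def_s addKn; nia.
Qed.

(** The Hilbert polynomial of a plane curve of degree [g], with [tri (g - 2)] as arithmetic genus;
    at [g = 1] truncation gives genus 0, as it should. *)
Lemma tri_hilbert t g : (0 < g)%N -> (g <= t)%N ->
  (tri t.+1 - tri (t - g).+1 + tri (g - 2) = t * g + 1)%N.
Proof.
move=> g0 leg; have le_tri : (tri (t - g).+1 <= tri t.+1)%N by apply: leq_tri; lia.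
have [q def_t] : exists q, t = (g + q)%N by exists (t - g)%N; lia.
move: le_tri; rewrite def_t addKn.
have d1 := tri_double (g + q).+1; have d2 := tri_double q.+1.
have d3 := tri_double (g - 2).
case: g g0 d1 d3 {leg def_t} => // -[|g] _; first by rewrite /=; nia.
by rewrite subSS subSS subn0; nia.
Qed.

(** * Functions on a plane curve and the Bezout inequality *)

Section PlaneCurve.
Variables (K : closedFieldType) (G : {poly {poly K}}) (gam : nat).
Local Notation A := {poly {poly K}}.
Local Notation io := (@iota K).
Local Notation dimge := (@dim_ge K A (@iota K)).
Local Notation dimle := (@dim_le K A (@iota K)).
Local Notation subsp := (@subspace K A (@iota K)).
Local Notation lc := (@lcomb K A (@iota K) _).
Hypotheses (irG : birreducible G) (degG : size (chi (0, 0) G) = gam.+1).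

Let m P := mult P G.

Let nzG : G != 0. Proof. exact: birreducible_neq0. Qed.
Let prG : bprime G. Proof. exact: birreducible_prime. Qed.

Lemma curve_deg_gt0 : (0 < gam)%N.
Proof.
rewrite lt0n; apply/negP => /eqP g0; have [nG _] := irG; apply: nG.
exists G`_0`_0; apply/polyP => j; rewrite coefC; apply/polyP => i.
have G0 : (0 < i + j)%N -> G`_j`_i = 0.
  by apply: deg_le_coef; rewrite /deg_le degG g0.
case: j G0 => [|j] /= G0; last by rewrite coef0 G0 // addnS.
by rewrite coefC; case: i G0 => //= i G0; rewrite G0.
Qed.

Let gam0 := curve_deg_gt0.

Lemma divides_mul f h : divides G f -> divides G (h * f).
Proof. by case=> q ->; exists (h * q); rewrite mulrCA. Qed.

Lemma subspace_divides : subsp (divides G).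
Proof.
split=> [|c f h [q ->] [q' ->]]; first by exists 0; rewrite mulr0.
by exists (io c * q + q'); rewrite mulrDr mulrCA.
Qed.

Lemma deg_le_divl t h : (gam <= t)%N -> deg_le t (G * h) -> deg_le (t - gam) h.
Proof.
move=> leg; rewrite /deg_le (rmorphM (chi _)) /=.
have [->|nzh] := eqVneq h 0; first by rewrite (rmorph0 (chi _)) size_poly0.
by rewrite size_mul ?chi_eq0 // degG; set a := size _; lia.
Qed.

(** The dimension on the curve of the polynomials of degree at most [t], meaningful for [gam <= t],
    where the multiples of [G] have dimension [tri (t - gam).+1]. *)
Definition hilb t := (tri t.+1 - tri (t - gam).+1)%N.

Lemma hilbE t : (gam <= t)%N -> (hilb t + tri (gam - 2) = t * gam + 1)%N.
Proof. exact: tri_hilbert. Qed.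

Lemma dim_curve_ge t : (gam <= t)%N -> dimge (deg_le t) (divides G) (hilb t).
Proof.
move=> leg; apply: (dim_ge_quotient (U := eq^~ 0)) => //.
- exact: subspace_deg_le.
- exact: subspace_divides.
- exact: dim_deg_le_ge.
case=> e [De ie]; apply: (@dim_deg_le_le K (t - gam)).
have /fin_all_exists[h def_e] i : exists h, e i = G * h by case: (De i).
exists h; split=> [i|c h0].
  by apply: deg_le_divl => //; rewrite -def_e; case: (De i).
apply: ie; have -> : lc c e = G * lc c h; last by rewrite h0 mulr0.
by rewrite -lcomb_mul; apply: eq_bigr => i _; rewrite def_e.
Qed.

Lemma dim_curve_le t : (gam <= t)%N -> dimle (deg_le t) (divides G) (hilb t).
Proof.
move=> leg dt; apply: (@dim_deg_le_le K t).
have sY := subspaceI (subspace_deg_le K t) subspace_divides.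
have d1 : dimge (deg_le t) (fun f => deg_le t f /\ divides G f) (hilb t).+1.
  by apply: dim_ge_sub dt => // f [].
have d2 : dimge (fun f => deg_le t f /\ divides G f) (eq^~ 0) (tri (t - gam).+1).
  apply: dim_ge_mul (dim_deg_le_ge K (t - gam)) => [f df|f].
    split; last by exists f.
    by rewrite -(subnKC leg); apply: deg_leM => //; rewrite /deg_le degG.
  by move/eqP; rewrite mulf_eq0 (negPf nzG) => /eqP.
have := dim_geD sY _ _ d1 d2; rewrite addSn /hilb subnK; last by apply: leq_tri; lia.
by apply=> [f ->|f []] //; case: sY.
Qed.

(** The ideal [J s] of the overview, as the sum of [ord_space L s] and the multiples of [G]. *)
Definition jspace L s (f : A) := exists h, ord_space L s (f - G * h).

Lemma subspace_jspace L s : subsp (jspace L s).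
Proof.
have sW := subspace_ord_space L s.
split=> [|c f h [q Wf] [q' Wh]]; first by exists 0; rewrite mulr0 subrr; case: sW.
exists (io c * q + q'); case: sW => _ /(_ c _ _ Wf Wh).
by congr (ord_space L s _); ring.
Qed.

Lemma divides_jspace L s f : divides G f -> jspace L s f.
Proof.
by case=> h ->; exists h; rewrite subrr; case: (subspace_ord_space L s).
Qed.

Lemma jspace_mul L s h f : jspace L s f -> jspace L s (h * f).
Proof.
case=> q Wf; exists (h * q) => P LP.
by have -> : h * f - G * (h * q) = h * (f - G * q) by [ring]; apply/ord_geMl/Wf.
Qed.

Lemma jspaceM L s s' f h : jspace L s f -> jspace L s' h ->
  jspace L (fun P => s P + s' P)%N (f * h).
Proof.
case=> q Wf [q' Wh]; exists (q * h + (f - G * q) * q') => P LP.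
have -> : f * h - G * (q * h + (f - G * q) * q') = (f - G * q) * (h - G * q').
  by ring.
by apply: ord_geM; [apply: Wf|apply: Wh].
Qed.

Lemma jspaceX L s n f : jspace L s f -> jspace L (fun P => n * s P)%N (f ^+ n).
Proof.
case=> q Wf; elim: n => [|n [q' IHn]]; first by exists 0 => P _.
exists (q * f ^+ n + (f - G * q) * q') => P LP; rewrite exprS mulSn.
have -> : f * f ^+ n - G * (q * f ^+ n + (f - G * q) * q')
  = (f - G * q) * (f ^+ n - G * q') by ring.
by apply: ord_geM; [apply: Wf|apply: IHn].
Qed.

Lemma jspaceW L s s' f : (forall P, P \in L -> s P <= s' P)%N ->
  jspace L s' f -> jspace L s f.
Proof.
by move=> le_s [h Wf]; exists h => P LP; apply: ord_geW (le_s P LP) (Wf P LP).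
Qed.

Definition jcodim L s := (\sum_(P <- L) (tri (s P) - tri (s P - m P)))%N.

Lemma jcodimE L s : (\sum_(P <- L) tri (s P) =
  jcodim L s + \sum_(P <- L) tri (s P - m P))%N.
Proof.
rewrite -big_split; apply: eq_bigr => P _ /=.
by rewrite subnK // leq_tri // leq_subr.
Qed.

(** The sum [S] of the overview. *)
Definition delta L := (\sum_(P <- L) tri (m P).-1)%N.

Lemma jcodim_large L s : (forall P, P \in L -> m P <= (s P).+1)%N ->
  (jcodim L s + delta L = \sum_(P <- L) m P * s P)%N.
Proof.
move=> le_m; rewrite -big_split; apply: eq_big_seq => P LP /=.
exact/tri_sub/le_m.
Qed.

(** Inside [jspace L s], the multiples [G * h] modulo [ord_space L s] are counted by [h] modulo
    orders [s P - m P]. Taking them off the conditions for orders [s] leaves [jcodim]. *)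
Lemma jcodim_le L s : uniq L -> dimle (fun=> True) (jspace L s) (jcodim L s).
Proof.
move=> uL dJ; apply: (@codim_ord_space_le K L s).
have sJ := subspace_jspace L s.
have := dim_geD sJ _ _ dJ (_ : dimge _ (ord_space L s) (\sum_(P <- L) tri (s P - m P))).
rewrite jcodimE addSn; apply=> // [f Wf|]; first by exists 0; rewrite mulr0 subr0.
apply: dim_ge_mul (codim_ord_space_ge (fun P => s P - m P)%N uL) => f.
  by move=> _; apply: divides_jspace; exists f.
by move=> Wf P LP; apply: ord_ge_divl (Wf P LP).
Qed.

Lemma jcodim_ge L s : uniq L -> dimge (fun=> True) (jspace L s) (jcodim L s).
Proof.
move=> uL; have -> : jcodim L s = (\sum_(P <- L) tri (s P) -
    \sum_(P <- L) tri (s P - m P))%N by rewrite jcodimE addnK.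
apply: dim_ge_quotient (codim_ord_space_ge s uL) _ => //.
  exact: subspace_jspace.
case=> e [Je ie]; apply: (@codim_ord_space_le K L (fun P => s P - m P)%N).
have /fin_all_exists[h Wh] i : exists h, ord_space L s (e i - G * h) by case: (Je i).
exists h; split=> // c Wc; apply: ie.
have -> : lc c e = lc c (fun i => e i - G * h i) + G * lc c h.
  by rewrite -lcomb_mul -lcomb_add; apply: eq_bigr => i _; rewrite subrK.
have sW := subspace_ord_space L s.
apply: (subspaceD sW); first exact: subspace_lcomb.
move=> P LP; apply: (@ord_geW _ _ _ (m P + (s P - m P))%N); first by lia.
by apply: ord_geM; [apply: ord_ge_mult|apply: Wc].
Qed.

Lemma dim_jspace_ge L s t q : uniq L -> (gam <= t)%N ->
    (jcodim L s + q <= hilb t)%N ->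
  dimge (fun f => deg_le t f /\ jspace L s f) (divides G) q.
Proof.
move=> uL leg le_q; apply: (@dim_ge_leq _ _ _ _ _ _ (hilb t - jcodim L s)); first by lia.
apply: dim_ge_subspace (dim_curve_ge leg) _.
- exact: subspace_deg_le.
- exact: subspace_jspace.
by refine (dim_le_sub _ _ (@jcodim_le L s uL)).
Qed.

(** Modulo the prime [G], multiplication by [f] embeds [J m] in degree [T] into [J (m + k)] in
    degree [t + T]. For [T] large, the first has dimension at least [hilb T - jcodim L m], the
    second at most [hilb (t + T) - jcodim L mk]. The Hilbert terms differ by [t * gam], the
    codimensions by the sum of the [m P * k P]. *)
Lemma bezout L k t f : uniq L -> deg_le t f -> jspace L k f -> ~ divides G f ->
  (\sum_(P <- L) m P * k P <= t * gam)%N.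
Proof.
(* Starting from orders [m] puts both [m] and [m + k] in the range of [jcodim_large]. *)
move=> uL df Jf nGf; pose mk P := (m P + k P)%N.
have [e [_ ie]] := jcodim_ge mk uL.
have [T1 De] := deg_le_exn e.
(* [T] must reach [gam] and the degrees of the family [e] that realises [jcodim L mk], and must make
   [hilb T - jcodim L m] a genuine difference. *)
pose T := (gam + T1 + jcodim L m + tri (gam - 2))%N.
have leT : (gam <= T)%N by rewrite /T; lia.
have leT' : (gam <= t + T)%N by lia.
have big : (jcodim L m <= hilb T)%N.
  by have := hilbE leT; have : (T <= T * gam)%N := leq_pmulr _ gam0; rewrite {1}/T; lia.
have sY := subspaceI (subspace_deg_le K (t + T)) (subspace_jspace L mk).
have d1 : dimge (fun f => deg_le (t + T) f /\ jspace L mk f) (divides G)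
    (hilb T - jcodim L m).
  have : dimge (fun f => deg_le T f /\ jspace L m f) (divides G) (hilb T - jcodim L m).
    by apply: dim_jspace_ge; rewrite ?subnKC.
  apply: (@dim_ge_mul _ _ _ _ _ _ _ f) => h; last by case/prG.2.
  case=> dh Jh; split; first exact: deg_leM.
  by apply: jspaceW (jspaceM Jf Jh) => P _; rewrite addnC.
have d2 : dimge (deg_le (t + T)) (fun f => deg_le (t + T) f /\ jspace L mk f)
    (jcodim L mk).
  exists e; split=> [i|c [_ /ie//]].
  by apply: deg_leW (De i); rewrite /T; lia.
have d3 : dimge (deg_le (t + T)) (fun f => deg_le (t + T) f /\ divides G f)
    (jcodim L mk + (hilb T - jcodim L m)).
  apply: (dim_geD sY _ _ d2) => [f' [df' Gf']|f' []|] //.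
    by split=> //; apply: divides_jspace.
  by apply: dim_ge_sub d1 => // f' [].
have d4 : dimge (deg_le (t + T)) (divides G) (jcodim L mk + (hilb T - jcodim L m)).
  by apply: dim_ge_mod d3; first exact: subspace_deg_le.
have le_dim := dim_ge_le d4 (@dim_curve_le _ leT').
have cmk := @jcodim_large L mk (fun P _ => leqW (leq_addr _ _)).
have cm := @jcodim_large L m (fun P _ => leqnSn _).
have : (\sum_(P <- L) m P * mk P = \sum_(P <- L) m P * m P + \sum_(P <- L) m P * k P)%N.
  by rewrite -big_split; apply: eq_bigr => P _; rewrite /= mulnDr.
have := hilbE leT; have := hilbE leT'; rewrite mulnDl; move: le_dim big cmk cm.
by lia.
Qed.

End PlaneCurve.

(** * Comparison of [delta] with the arithmetic genus *)

Section GenusZero.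
Variables (K : closedFieldType) (G : {poly {poly K}}) (gam : nat).
Local Notation A := {poly {poly K}}.
Local Notation dimle := (@dim_le K A (@iota K)).
Hypotheses (irG : birreducible G) (degG : size (chi (0, 0) G) = gam.+1).

Let m P := mult P G.
Let pa := tri (gam - 2).
Let gam0 : (0 < gam)%N := curve_deg_gt0 irG degG.

Lemma sum_mult_pred L : (\sum_(P <- L) m P * (m P).-1 = delta G L * 2)%N.
Proof.
rewrite /delta big_distrl; apply: eq_bigr => P _ /=; rewrite tri_double -/(m P).
by case: (m P) => //= n; rewrite mulnC.
Qed.

Lemma leq_predS P : (m P <= (m P).-1.+1)%N.
Proof. by case: (m P). Qed.

Lemma jspace_nontrivial L s t : uniq L -> (gam <= t)%N ->
    (jcodim G L s < hilb gam t)%N ->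
  exists f, [/\ deg_le t f, jspace G L s f & ~ divides G f].
Proof.
move=> uL leg lt_c.
have [|f [df Jf] nGf] := dim_ge1 (@dim_jspace_ge K G gam irG degG L s t 1 uL leg _).
  by rewrite addn1.
by exists f.
Qed.

(** Take orders [m P - 1] everywhere and as many more at [P1] as still leave a nonzero function of
    degree [t] on the curve. If [delta G L >= pa + m P1], its intersection number with the curve
    exceeds [t * gam], against Bezout. *)
Lemma delta_bound L P1 : uniq L -> P1 \in L -> (0 < m P1)%N ->
  (delta G L < pa + m P1)%N.
Proof.
move=> uL LP1 m1; rewrite ltnNge; apply/negP => ge_d.
set S := delta G L in ge_d.
pose t := (gam + S * 2)%N; have leg : (gam <= t)%N by rewrite /t; lia.
have big : (t <= t * gam)%N := leq_pmulr _ gam0.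
(* The largest [j] for which the [S + j * m P1] conditions stay below
   [hilb gam t = t * gam + 1 - pa]. *)
pose j := ((t * gam - S - pa) %/ m P1)%N.
have le_j : (j * m P1 <= t * gam - S - pa)%N := leq_trunc_div _ _.
have lt_j : (t * gam - S - pa < j.+1 * m P1)%N by rewrite ltn_ceil.
pose s P := ((m P).-1 + (P == P1) * j)%N.
have sum_s : (\sum_(P <- L) m P * s P = S * 2 + j * m P1)%N.
  rewrite /S -sum_mult_pred (bigD1_seq P1) //= [in RHS](bigD1_seq P1) //=.
  rewrite /s eqxx mul1n.
  under eq_bigr => P /negPf-> do rewrite mul0n addn0.
  by rewrite mulnDr -addnA [X in (_ + X)%N]addnC addnA [(m P1 * j)%N]mulnC.
have cs : (jcodim G L s + S = \sum_(P <- L) m P * s P)%N.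
  apply: jcodim_large => P _; rewrite /s -/(m P); have := leq_predS P; lia.
have hs := hilbE irG degG leg; rewrite -/pa in hs.
have [|f [df Jf nGf]] := @jspace_nontrivial L s t uL leg.
  by move: cs hs le_j big; rewrite sum_s /t; lia.
have := bezout irG degG uL df Jf nGf; rewrite -/m sum_s.
by move: lt_j big le_j ge_d; rewrite mulSn /t; lia.
Qed.

(** A point of multiplicity at least 2 adds at least 1 to [delta], which [delta_bound] keeps bounded
    on lists through a fixed [P1]. As the curve has infinitely many points, some point outside [L]
    is simple. *)
Lemma exists_simple_point (L : seq (K * K)) : exists2 Q, Q \notin L & m Q = 1%N.
Proof.
have nzG := birreducible_neq0 irG.
apply: NNPP => no_simple.
have on_curve P : ord_ge P 1 G -> P \notin L -> (1 < m P)%N.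
  move=> oP nP; have mP : (1 <= m P)%N by apply/ord_geP.
  by rewrite ltn_neqAle mP andbT; apply/negP => /eqP m1; apply: no_simple; exists P.
have [P1 nP1 oP1] := curve_point_notin L irG.
have m1 := on_curve _ oP1 nP1.
have lists n : exists L', [/\ uniq L', size L' = n.+1, P1 \in L' &
    forall P, P \in L' -> (1 < m P)%N].
  elim: n => [|n [L' [uL' sL' L'P1 mL']]].
    exists [:: P1]; split; [by []|by []|exact: mem_head|move=> P].
    by rewrite inE => /eqP->.
  have [P nP oP] := curve_point_notin (L ++ L') irG.
  move: nP; rewrite mem_cat negb_or => /andP[nLP nL'P].
  exists (P :: L'); split; last 1 first.
  - by move=> P'; rewrite inE => /orP[/eqP->|/mL']; first exact: on_curve.
  - by rewrite /= nL'P.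
  - by rewrite /= sL'.
  by rewrite inE L'P1 orbT.
have [L' [uL' sL' L'P1 mL']] := lists (pa + m P1)%N.
have := delta_bound uL' L'P1 (ltnW m1); rewrite ltnNge => /negP; apply.
apply: (@leq_trans (size L')); first by rewrite sL'.
rewrite -sum1_size /delta !big_seq; apply: leq_sum => P /mL'.
by rewrite tri_gt0 -/(m P); case: (m P) => [|[]].
Qed.

(** For [gam >= 3], [pa] is the dimension of the polynomials of degree [gam - 3], and [delta G L]
    bounds the conditions for orders [m P - 1]: fewer conditions than [pa] would leave a nonzero
    adjoint. *)
Lemma delta_ge_genus L :
    (forall f, (3 <= gam)%N -> deg_le (gam - 3) f ->
       ord_space L (fun P => (m P).-1) f -> f = 0) ->
  (pa <= delta G L)%N.
Proof.
move=> no_adj; rewrite leqNgt; apply/negP => lt_d.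
(* In degree below 3, [pa] is 0 and cannot exceed [delta G L]. *)
have g3 : (3 <= gam)%N.
  by rewrite leqNgt; apply/negP => lt3; move: lt_d; rewrite /pa (_ : gam - 2 = 0)%N //; lia.
pose W := ord_space L (fun P => (m P).-1).
have dW : dimle (deg_le (gam - 3)) W (delta G L).
  by refine (dim_le_sub _ _ (@codim_ord_space_le K L (fun P => (m P).-1))).
have dD := dim_deg_le_ge K (gam - 3).
have := dim_ge_subspace (subspace_deg_le K _) (subspace_ord_space L _) dD dW.
rewrite (_ : (gam - 3).+1 = gam - 2)%N; last by lia.
move/(@dim_ge_leq _ _ _ _ _ 1); rewrite subn_gt0 => /(_ lt_d)/dim_ge1[f [df of_]].
by apply; apply: no_adj.
Qed.

End GenusZero.

(** * Binary forms in two polynomials independent on the curve *)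

Section Pencil.
Variables (K : closedFieldType) (G H0 H1 : {poly {poly K}}).
Local Notation A := {poly {poly K}}.
Hypothesis prG : bprime G.
Hypothesis indH : forall c0 c1, divides G (iota c0 * H0 + iota c1 * H1) ->
  c0 = 0 /\ c1 = 0.

Definition frac_const (c : K) : {fraction A} := tofrac (iota c).
HB.instance Definition _ := GRing.RMorphism.copy frac_const (@tofrac A \o @iota K).

(** Computed in fractions of the ambient polynomial ring; [G] enters only once denominators are
    cleared. *)
Definition pencil_value (p : {poly K}) : {fraction A} :=
  (map_poly frac_const p).[tofrac H0 / tofrac H1].
HB.instance Definition _ := GRing.RMorphism.copy pencil_value
  (horner_eval (tofrac H0 / tofrac H1) \o map_poly frac_const).

Lemma pencil_not_divides c0 c1 : (c0 != 0) || (c1 != 0) ->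
  ~ divides G (iota c0 * H0 + iota c1 * H1).
Proof. by move=> nz /indH[c00 c10]; rewrite c00 c10 eqxx in nz. Qed.

Lemma not_divides_H1 : ~ divides G H1.
Proof.
have := @pencil_not_divides 0 1; rewrite iota0 iota1 mul0r mul1r add0r; apply.
by rewrite oner_eq0 orbT.
Qed.

Lemma pencil_H1_neq0 : H1 != 0.
Proof. by apply: contraPneq not_divides_H1 => -> []; exists 0; rewrite mulr0. Qed.

Lemma pencil_valueC c : pencil_value c%:P = tofrac (iota c).
Proof. by rewrite /pencil_value map_polyC hornerC. Qed.

Lemma pencil_valueXsubC z :
  tofrac H1 * pencil_value ('X - z%:P) = tofrac (H0 - iota z * H1).
Proof.
rewrite (rmorphB pencil_value) /= pencil_valueC mulrBr.
rewrite (rmorphB (@tofrac A)) /= (rmorphM (@tofrac A)) /=; congr (_ - _); last exact: mulrC.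
by rewrite /pencil_value map_polyX hornerX mulrC divfK // tofrac_eq0 pencil_H1_neq0.
Qed.

Lemma not_dividesM f h : ~ divides G f -> ~ divides G h -> ~ divides G (f * h).
Proof. by move=> nf nh /prG.2[]. Qed.

Lemma not_dividesX f n : ~ divides G f -> ~ divides G (f ^+ n).
Proof.
by move=> nf; elim: n => [|n IHn]; [exact: prG.1|rewrite exprS; exact: not_dividesM].
Qed.

Lemma not_divides_iota c : c != 0 -> ~ divides G (iota c).
Proof.
move=> nzc [h def_c]; apply: prG.1; exists (h * iota c^-1).
by rewrite mulrA -def_c -rmorphM /= mulfV ?rmorph1.
Qed.

(* Over an algebraically closed field a binary form is a product of linear
   forms, and none of these vanishes on the curve. *)
Lemma binary_form_not_divides (p : {poly K}) n f : p != 0 ->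
  tofrac f = tofrac H1 ^+ n * pencil_value p -> ~ divides G f.
Proof.
move=> nzp def_f.
have [rs def_p] := closed_field_poly_normal p.
have nzl : lead_coef p != 0 by rewrite lead_coef_eq0.
(* Each of the [size rs] linear factors of [p] takes one [H1] to clear its denominator. *)
suff eqf : f * H1 ^+ size rs =
    H1 ^+ n * (iota (lead_coef p) * \prod_(z <- rs) (H0 - iota z * H1)).
  move=> /(divides_mul (H1 ^+ size rs)); rewrite mulrC eqf.
  apply: not_dividesM; first exact/not_dividesX/not_divides_H1.
  apply: not_dividesM; first exact: not_divides_iota.
  elim: rs {def_p eqf} => [|z rs IHrs]; first by rewrite big_nil; case: prG.
  rewrite big_cons; apply: not_dividesM IHrs.
  have := @pencil_not_divides 1 (- z).
  by rewrite iota1 mul1r iotaN mulNr; apply; rewrite oner_eq0.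
have prodE : tofrac H1 ^+ size rs * pencil_value (\prod_(z <- rs) ('X - z%:P)) =
    tofrac (\prod_(z <- rs) (H0 - iota z * H1)).
  elim: rs {def_p} => [|z rs IHrs].
    by rewrite !big_nil (rmorph1 pencil_value) (rmorph1 (@tofrac A)) mulr1.
  rewrite !big_cons (rmorphM pencil_value) (rmorphM (@tofrac A)) /= -IHrs exprS.
  by rewrite -pencil_valueXsubC mulrACA.
apply/eqP; rewrite -tofrac_eq; apply/eqP.
rewrite !(rmorphM (@tofrac A)) /= !(rmorphXn (@tofrac A)) /=.
rewrite -prodE def_f [in LHS]def_p -mul_polyC (rmorphM pencil_value) /= pencil_valueC.
rewrite -mulrA; congr (_ * _); rewrite -mulrA; congr (_ * _); exact: mulrC.
Qed.

(** The homogenization of [p] in degree [n]. Coefficients of index above [n] are dropped, hence the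
    bounds on [size p] below. *)
Definition binary_form n (p : {poly K}) : A :=
  \sum_(a < n.+1) iota p`_a * (H0 ^+ a * H1 ^+ (n - a)).

Lemma tofrac_binary_form n (p : {poly K}) : (size p <= n.+1)%N ->
  tofrac (binary_form n p) = tofrac H1 ^+ n * pencil_value p.
Proof.
move=> sp; have nzF : tofrac H1 != 0 by rewrite tofrac_eq0 pencil_H1_neq0.
rewrite (rmorph_sum (@tofrac A)) /= /pencil_value (@horner_coef_wide _ n.+1); last first.
  by apply: leq_trans sp; apply: size_poly.
rewrite mulr_sumr; apply: eq_bigr => a _; rewrite coef_map /=.
rewrite (rmorphM (@tofrac A)) (rmorphM (@tofrac A)) !(rmorphXn (@tofrac A)) /=.
rewrite [RHS]mulrCA; congr (_ * _); rewrite expr_div_n [RHS]mulrCA; congr (_ * _).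
by rewrite exprB ?unitfE // -ltnS.
Qed.

End Pencil.

(** * A rational pencil on a curve of genus zero *)

Section Parametrization.
Variables (K : closedFieldType) (G : {poly {poly K}}) (gam : nat).
Local Notation A := {poly {poly K}}.
Local Notation io := (@iota K).
Local Notation dimge := (@dim_ge K A (@iota K)).
Local Notation dimle := (@dim_le K A (@iota K)).
Local Notation lc := (@lcomb K A (@iota K) _).
Hypotheses (irG : birreducible G) (degG : size (chi (0, 0) G) = gam.+1).

Let m P := mult P G.
Let pa := tri (gam - 2).
Let gam0 : (0 < gam)%N := curve_deg_gt0 irG degG.

(* A system of residual degree [rho] has dimension at most [rho + 1]: otherwise
   [rho + 1] further conditions at the simple point [Q] would violate Bezout. *)
Lemma dim_jspace_le L s t rho Q : uniq L -> Q \in L -> m Q = 1%N ->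
    (forall P, P \in L -> m P <= (s P).+1)%N ->
    (\sum_(P <- L) m P * s P + rho = t * gam)%N ->
  dimle (fun f => deg_le t f /\ jspace G L s f) (divides G) rho.+1.
Proof.
move=> uL LQ mQ le_s sum_s; pose s' P := (s P + (P == Q) * rho.+1)%N.
have sum_s' : (\sum_(P <- L) m P * s' P = \sum_(P <- L) m P * s P + rho.+1)%N.
  rewrite (bigD1_seq Q) //= [in RHS](bigD1_seq Q) //=.
  rewrite /s' eqxx mul1n mQ !mul1n.
  under eq_bigr => P /negPf-> do rewrite mul0n addn0.
  by rewrite -!addnA [(rho.+1 + _)%N]addnC.
have le_s' P : P \in L -> (m P <= (s' P).+1)%N.
  by move/le_s => le; apply: leq_trans le _; rewrite ltnS leq_addr.
have c : (jcodim G L s + delta G L = \sum_(P <- L) m P * s P)%N := jcodim_large le_s.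
have c' : (jcodim G L s' + delta G L = \sum_(P <- L) m P * s' P)%N := jcodim_large le_s'.
have sX := subspaceI (subspace_deg_le K t) (subspace_jspace G L s).
have sY := subspace_jspace G L s'.
have -> : rho.+1 = (rho.+1 + 0)%N by rewrite addn0.
(* Either [rho.+2] elements are independent modulo [jspace G L s'], exceeding the [rho.+1]
   conditions that cut it out of [jspace G L s], or an element of it is not divisible by [G],
   against Bezout. *)
move=> dX; have [d1|/dim_ge1[e [[de _] Je] nGe]] := dim_ge_split sX sY dX.
  apply: (@jcodim_le K G irG L s' uL).
  have d2 : dimge (fun=> True) (jspace G L s') (jcodim G L s + rho.+2).
    apply: (@dim_geD _ _ _ _ (jspace G L s)) => //; first exact: subspace_jspace.
    - by move=> f; apply: jspaceW => P _; apply: leq_addr.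
    - exact: (jcodim_ge irG degG s uL).
    by apply: dim_ge_sub d1 => // f [].
  by apply: dim_ge_leq d2; move: c c'; rewrite sum_s'; lia.
have : (\sum_(P <- L) m P * s' P <= t * gam)%N := bezout irG degG uL de Je nGe.
by rewrite sum_s'; lia.
Qed.

(** Once [delta] equals the genus, a system has dimension at least its residual degree plus 1. A
    simple point [Q] adds nothing to [delta] and 1 to the degree per unit of order, so residual
    degrees can be prescribed: 1 for the pencil, 0 for [M], and [gam] for the system that contains
    the [M * u]. *)
Lemma rational_pencil L : uniq L ->
    (forall f, (3 <= gam)%N -> deg_le (gam - 3) f ->
       ord_space L (fun P => (m P).-1) f -> f = 0) ->
  exists M H0 H1 : A, [/\ ~ divides G M,
    forall c0 c1, divides G (iota c0 * H0 + iota c1 * H1) -> c0 = 0 /\ c1 = 0 &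
    forall u, deg_le 1 u -> exists2 p : {poly K}, (size p <= gam.+1)%N &
      divides G (M * u - binary_form H0 H1 gam p)].
Proof.
move=> uL no_adj; have prG := birreducible_prime irG.
have [Q nLQ mQ] := exists_simple_point irG degG L; rewrite -/(m Q) in mQ.
have uQL : uniq (Q :: L) by rewrite /= nLQ.
set S := delta G (Q :: L).
have geS : (pa <= S)%N.
  rewrite /S /delta big_cons; apply: leq_trans (leq_addl _ _).
  exact: delta_ge_genus.
have leS : (S <= pa)%N.
  by have := delta_bound irG degG uQL (mem_head _ _); rewrite -/(m Q) mQ addn1 ltnS; apply.
have eqS : S = pa by apply/eqP; rewrite eqn_leq leS geS.
(* Large enough for the order of [k] at [Q] to be a genuine difference, and for the Hilbert formula
   in degrees [n] and [n * gam - 1]. *)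
pose n := (gam + S * 2 + 1)%N.
have big : (n <= n * gam)%N := leq_pmulr _ gam0.
pose k P := if P == Q then (n * gam - S * 2 - 1)%N else (m P).-1.
have mk P : (m P <= (k P).+1)%N.
  by rewrite /k; case: eqP => [->|_]; [rewrite mQ|exact: leq_predS].
have sum_k : (\sum_(P <- Q :: L) m P * k P = n * gam - 1)%N.
  rewrite big_cons {1}/k eqxx mQ mul1n.
  have -> : (\sum_(P <- L) m P * k P = S * 2)%N.
    rewrite /S /delta big_cons -/(m Q) mQ add0n -sum_mult_pred.
    by apply: eq_big_seq => P LP; rewrite /k; case: eqP => // eqPQ; rewrite -eqPQ LP in nLQ.
  by move: big; rewrite /n; lia.
have sum_gk : (\sum_(P <- Q :: L) m P * (gam * k P) = gam * (n * gam - 1))%N.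
  by rewrite -sum_k big_distrr /=; apply: eq_bigr => P _; rewrite mulnCA.
have mgk P : (m P <= (gam * k P).+1)%N.
  by apply: leq_trans (mk P) _; rewrite ltnS leq_pmull.
have ck : (jcodim G (Q :: L) k + S = n * gam - 1)%N.
  by rewrite -sum_k; apply: jcodim_large => P _; apply: mk.
have cgk : (jcodim G (Q :: L) (fun P => gam * k P) + S = gam * (n * gam - 1))%N.
  by rewrite -sum_gk; apply: jcodim_large => P _; apply: mgk.
have len : (gam <= n)%N by rewrite /n; lia.
have len' : (gam <= n * gam - 1)%N.
  have le1 : (gam.+1 * gam <= n * gam)%N by apply: leq_mul => //; rewrite /n; lia.
  by have le2 : (gam <= gam * gam)%N := leq_pmulr _ gam0; move: le1; rewrite mulSn; lia.
have hn := hilbE irG degG len; have hn' := hilbE irG degG len'.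
(* Because [S = pa], [hilb gam n] exceeds the codimension by exactly 2. *)
have [|H [DH iH]] := @dim_jspace_ge K G gam irG degG (Q :: L) k n 2 uQL len.
  by move: ck hn; rewrite -/pa -eqS; lia.
(* Orders [gam * k] in degree [n * gam - 1] leave residual degree 0, hence room for one function. *)
have [|M [dM JM nGM]] := @jspace_nontrivial K G gam irG degG (Q :: L)
  (fun P => gam * k P)%N (n * gam - 1) uQL len'.
  by move: cgk hn'; rewrite -/pa -eqS; lia.
have indH c0 c1 : divides G (iota c0 * H 0 + iota c1 * H 1) -> c0 = 0 /\ c1 = 0.
  move=> GH; have c0E : (\row_i if i == 0 then c0 else c1) = 0 :> 'rV[K]_2.
    have e1 : lift ord0 0 = 1 :> 'I_2 by apply: val_inj.
    by apply: iH; rewrite /lcomb big_ord_recl big_ord1 e1 !mxE.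
  by split; [have /rowP/(_ 0) := c0E|have /rowP/(_ 1) := c0E]; rewrite !mxE.
exists M, (H 0), (H 1); split=> // u du.
(* These [gam.+2] elements lie in a system of residual degree [gam], of dimension at most [gam.+1],
   and are therefore dependent on the curve. *)
pose e (i : 'I_gam.+2) := if (i < gam.+1)%N then H 0 ^+ i * H 1 ^+ (gam - i) else M * u.
have [c [Gc nzc]] : exists c, divides G (lc c e) /\ c <> 0.
  apply: NNPP => ind; have := @dim_jspace_le (Q :: L) (fun P => gam * k P)%N
    (n * gam) gam Q uQL (mem_head _ _) mQ (fun P _ => mgk P).
  case; first by rewrite sum_gk; nia.
  exists e; split=> [i|c Gc]; last by apply: NNPP => nzc; apply: ind; exists c.
  rewrite /e; case: ifP => lti.
    have [d0 J0] := DH 0; have [d1 J1] := DH 1; have lei : (i <= gam)%N by [].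
    split.
      have -> : (n * gam = i * n + (gam - i) * n)%N by rewrite -mulnDl subnKC // mulnC.
      by apply: deg_leM; apply: deg_leXn.
    apply: jspaceW (jspaceM (jspaceX i J0) (jspaceX (gam - i) J1)) => P _.
    by rewrite -mulnDl subnKC.
  split; first by apply: deg_leW (deg_leM dM du); move: big; rewrite /n; lia.
  by rewrite mulrC; apply: jspace_mul.
have lcE : lc c e = binary_form (H 0) (H 1) gam
    (\poly_(a < gam.+1) c 0 (inord a)) + iota (c 0 ord_max) * (M * u).
  rewrite /lcomb big_ord_recr /= {2}/e ltnn; congr (_ + _).
  apply: eq_bigr => a _; rewrite coef_poly ltn_ord /e /= ltn_ord.
  by congr (iota (c 0 _) * _); apply: val_inj; rewrite /= inordK // ltnS ltnW.
set q := \poly_(a < gam.+1) _ in lcE.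
have sq : (size q <= gam.+1)%N by apply: size_poly.
(* Without [M * u] the relation would be a nonzero binary form vanishing on the curve. *)
have nzl : c 0 ord_max != 0.
  apply/eqP => l0; case: nzc; rewrite lcE l0 iota0 mul0r addr0 in Gc.
  have q0 : q = 0.
    apply: NNPP => /eqP nzq.
    exact: (binary_form_not_divides prG indH nzq (tofrac_binary_form indH sq)).
  apply/rowP => i; rewrite mxE; have [lti|] := ltnP i gam.+1.
    have := congr1 (fun p : {poly K} => p`_i) q0.
    by rewrite coef0 coef_poly lti => <-; congr (c 0 _); apply: val_inj; rewrite /= inordK.
  move=> gei; rewrite -l0; congr (c 0 _); apply: val_inj => /=.
  by have := ltn_ord i; lia.
exists (- (c 0 ord_max)^-1 *: q); first by apply: leq_trans sq; apply: size_scale_leq.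
have -> : M * u - binary_form (H 0) (H 1) gam (- (c 0 ord_max)^-1 *: q)
  = iota (c 0 ord_max)^-1 * lc c e; last exact: divides_mul.
rewrite lcE mulrDr mulrA -(rmorphM io) /= mulVf // iota1 mul1r addrC; congr (_ + _).
rewrite /binary_form mulr_sumr -sumrN; apply: eq_bigr => a _.
by rewrite coefZ mulNr iotaN mulNr opprK (rmorphM io) /= mulrA.
Qed.

End Parametrization.

(** * Substitution in multivariate polynomials *)

Section MpolyMorphisms.
Variables (n : nat) (R : comNzRingType).

Lemma rmorph_mmap (S T : comNzRingType) (phi : {rmorphism S -> T})
    (f : R -> S) (h : 'I_n -> S) (p : {mpoly R[n]}) :
  phi (mmap f h p) = mmap (phi \o f) (phi \o h) p.
Proof.
rewrite /mmap rmorph_sum; apply: eq_bigr => m _ /=; rewrite rmorphM rmorph_prod.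
by congr (_ * _); apply: eq_bigr => i _; rewrite rmorphXn.
Qed.

Lemma eq_mmap (S : comNzRingType) (f f' : R -> S) (h h' : 'I_n -> S) (p : {mpoly R[n]}) :
  f =1 f' -> h =1 h' -> mmap f h p = mmap f' h' p.
Proof.
by move=> eqf eqh; apply: eq_bigr => m _; rewrite eqf; congr (_ * _); apply: mmap1_eq.
Qed.

Lemma mmap_dhomog (S : comNzRingType) (f : R -> S) (s : S) (h : 'I_n -> S) d
    (p : {mpoly R[n]}) :
  p \is d.-homog -> mmap f (fun i => s * h i) p = s ^+ d * mmap f h p.
Proof.
move=> /dhomogP hp; rewrite /mmap mulr_sumr; apply: eq_big_seq => m pm.
have <- : mdeg m = d := hp m pm.
rewrite mulrCA; congr (_ * _); rewrite /mmap1 mdegE -prodrXr -big_split /=.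
by apply: eq_bigr => i _; rewrite exprMn.
Qed.

End MpolyMorphisms.

(** * Factors of homogeneous polynomials *)

Section HomogeneousFactors.
Variables (n : nat) (R : idomainType).
Local Notation MP := {mpoly R[n]}.

(** As long as [d] is positive one factor vanishes at 0 and loses an ['X]; at [d = 0] both factors
    are constant by degree. *)
Lemma polyXn_factor (D : idomainType) (p q : {poly D}) c d : c != 0 ->
  p * q = c%:P * 'X^d -> exists u a, p = u%:P * 'X^a.
Proof.
move=> nzc; elim: d p q => [|d IHd] p q def_c.
  exists p`_0, 0%N; rewrite mulr1; apply: size1_polyC.
  have nzpq : p * q != 0 by rewrite def_c mulr1 polyC_eq0.
  move: (nzpq); rewrite mulf_eq0 negb_or => /andP[nzp nzq].
  have := congr1 (fun r : {poly D} => size r) def_c; rewrite mulr1 size_polyC nzc size_mul //.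
  by move: nzp nzq; rewrite -!size_poly_gt0; move: (size p) (size q); lia.
have nzX : 'X != 0 :> {poly D} by rewrite polyX_eq0.
have : p.[0] * q.[0] = 0 by rewrite -hornerM def_c hornerM hornerXn expr0n mulr0.
move/eqP; rewrite mulf_eq0 => /orP[]/factor_theorem[r]; rewrite subr0 => def_r.
  have [|u [a def_u]] := IHd r q.
    by apply: (mulIf nzX); rewrite mulrAC -def_r def_c exprSr mulrA.
  by exists u, a.+1; rewrite def_r def_u exprSr mulrA.
by apply: (IHd p r); apply: (mulIf nzX); rewrite -mulrA -def_r def_c exprSr mulrA.
Qed.

(** The homogeneous components are spread over the powers of a new variable, so that being
    homogeneous becomes being a monomial. *)
Definition scale_vars (f : MP) : {poly MP} :=
  mmap (polyC \o @mpolyC n R) (fun i => ('X_i)%:P * 'X) f.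
HB.instance Definition _ := GRing.RMorphism.copy scale_vars
  (mmap (polyC \o @mpolyC n R) (fun i => ('X_i)%:P * 'X)).

Lemma scale_varsE f : scale_vars f =
  \sum_(m <- msupp f) (f@_m *: 'X_[m])%:P * 'X^(mdeg m).
Proof.
apply: eq_bigr => m _ /=; rewrite -mul_mpolyC polyCM -mulrA; congr (_ * _).
rewrite mpolyXE_id rmorph_prod mdegE -prodrXr -big_split /=.
by apply: eq_bigr => i _; rewrite exprMn rmorphXn.
Qed.

Lemma coef_scale_vars f d : (scale_vars f)`_d = pihomog mdeg d f.
Proof.
rewrite scale_varsE coef_sum pihomogE [RHS]big_mkcond; apply: eq_bigr => m _.
by rewrite coefCM coefXn eq_sym; case: eqP => _; rewrite ?mulr1 ?mulr0.
Qed.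

Lemma scale_vars_dhomog f d : f \is d.-homog -> scale_vars f = f%:P * 'X^d.
Proof.
move=> hf; have := @mmap_dhomog n R {poly MP} (polyC \o @mpolyC n R) 'X
  (fun i => ('X_i)%:P) d f hf.
have -> : mmap (polyC \o @mpolyC n R) (fun i => 'X * ('X_i)%:P) f = scale_vars f.
  by apply: eq_mmap => // i; rewrite mulrC.
move=> ->; rewrite mulrC; congr (_ * _).
have /= <- := rmorph_mmap (@polyC MP) (@mpolyC n R) (fun i => 'X_i) f.
congr (_%:P); rewrite [RHS]mpolyE; apply: eq_bigr => m _.
by rewrite mul_mpolyC mmap1_id.
Qed.

(** [scale_vars] turns the factorization of [F] into one of a monomial, whose factors are monomials;
    evaluation at 1 recovers [f]. *)
Lemma dhomog_factor (F f h : MP) d : F != 0 -> F \is d.-homog -> F = f * h ->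
  exists e, f \is e.-homog.
Proof.
move=> nzF hF def_F; have := scale_vars_dhomog hF.
rewrite {1}def_F (rmorphM scale_vars) => /(polyXn_factor nzF)[u [e def_f]].
have e1 : (scale_vars f).[1] = f.
  rewrite scale_varsE horner_sum [RHS]mpolyE; apply: eq_bigr => m _.
  by rewrite hornerCM hornerXn expr1n mulr1.
have def_u : f = u by rewrite -e1 def_f hornerCM hornerXn expr1n mulr1.
exists e; have <- : pihomog mdeg e f = f; last exact: pihomogP.
by rewrite -coef_scale_vars def_f coefCM coefXn eqxx mulr1.
Qed.

End HomogeneousFactors.

(** * Passage between the projective plane and an affine chart *)

Section Dehomogenization.
Variables (K : closedFieldType) (c : K).
Local Notation A := {poly {poly K}}.
Local Notation R := {mpoly K[3]}.
Local Notation io := (@iota K).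
Local Notation F := {fraction {mpoly K[3]}}.

(** The line at infinity is [x0 + c x1 + c^2 x2 = 0]: this form is set to 1 and [x0] eliminated. The
    single parameter [c] is enough to avoid finitely many points. *)
Definition chart (i : 'I_3) : A :=
  match val i with
  | 0 => 1 - iota c * 'X%:P - iota (c ^+ 2) * 'X
  | 1 => 'X%:P
  | _ => 'X
  end.

Definition dehom (f : R) : A := mmap io chart f.
HB.instance Definition _ := GRing.RMorphism.copy dehom (mmap io chart).

Definition linf (v : 'I_3 -> K) : K := \sum_(i < 3) c ^+ i * v i.

Definition lform : R := \sum_(i < 3) (c ^+ i)%:MP * 'X_i.

Let i1 : 'I_3 := inord 1.
Let i2 : 'I_3 := inord 2.

Lemma ord3_sum (V : zmodType) (f : 'I_3 -> V) : \sum_i f i = f ord0 + f i1 + f i2.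
Proof.
rewrite !big_ord_recl big_ord0 addr0 addrA; congr (_ + f _ + f _);
by apply: val_inj; rewrite /= inordK.
Qed.

Lemma chart0 : chart ord0 = 1 - iota c * 'X%:P - iota (c ^+ 2) * 'X.
Proof. by []. Qed.

Lemma chart1 : chart i1 = 'X%:P.
Proof. by rewrite /chart /= inordK. Qed.

Lemma chart2 : chart i2 = 'X.
Proof. by rewrite /chart /= inordK. Qed.

Lemma sum_chart : \sum_(i < 3) iota (c ^+ i) * chart i = 1.
Proof.
rewrite ord3_sum chart0 chart1 chart2 /= !inordK // expr0 expr1 iota1 mul1r.
by rewrite addrAC subrK subrK.
Qed.

Lemma ord3P (i : 'I_3) : [\/ i = ord0, i = i1 | i = i2].
Proof.
case: i => [[|[|[|//]]] lti]; [constructor 1|constructor 2|constructor 3];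
by apply: val_inj; rewrite /= ?inordK.
Qed.

Lemma deg_le_chart i : deg_le 1 (chart i).
Proof.
case: (ord3P i) => ->; rewrite ?chart1 ?chart2; [|exact: deg_leX|exact: deg_leY].
rewrite chart0; apply: deg_leD; first apply: deg_leD.
- by rewrite -(iota1 K); apply: deg_leW (deg_le_iota 1).
- by apply/deg_leN/(deg_leM (deg_le_iota c) (deg_leX K)).
by apply/deg_leN/(deg_leM (deg_le_iota _) (deg_leY K)).
Qed.

Lemma dehomX i : dehom 'X_i = chart i.
Proof. by rewrite /dehom mmapX mmap1U. Qed.

Lemma dehomC k : dehom k%:MP = iota k.
Proof. by rewrite /dehom mmapC. Qed.

Lemma dehom_lform : dehom lform = 1.
Proof.
rewrite -sum_chart /lform (rmorph_sum dehom) /=; apply: eq_bigr => i _.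
by rewrite (rmorphM dehom) /= dehomC dehomX.
Qed.

Lemma deg_le_dehom d f : f \is d.-homog -> deg_le d (dehom f).
Proof.
move=> /dhomogP hf; have sd := subspace_deg_le K d.
rewrite /dehom /mmap big_seq; elim/big_ind: _ => [|x y|m fm]; first by case: sd.
  exact: deg_leD.
apply: (subspaceZ _ sd); have <- : mdeg m = d := hf m fm.
rewrite /mmap1 mdegE.
elim: (index_enum _) => [|i s IHs].
  by rewrite !big_nil -(iota1 K); apply: deg_le_iota.
rewrite !big_cons; apply: deg_leM => //; rewrite -[X in deg_le X]muln1.
exact/deg_leXn/deg_le_chart.
Qed.

Lemma lform_neq0 : lform != 0.
Proof.
apply/eqP => l0; have := dehom_lform; rewrite l0 (rmorph0 dehom) => /eqP.
by rewrite eq_sym oner_eq0.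
Qed.

Let nzL : tofrac lform != 0 :> F.
Proof. by rewrite tofrac_eq0 lform_neq0. Qed.

Definition mconst_frac (k : K) : F := tofrac (k%:MP : R).
HB.instance Definition _ := GRing.RMorphism.copy mconst_frac (@tofrac R \o @mpolyC 3 K).

(** The inverse substitution, with values in fractions; equalities between forms are checked there
    and brought back by injectivity of [tofrac]. *)
Definition rehom : A -> F :=
  bieval mconst_frac (tofrac ('X_i1 : R) / tofrac lform) (tofrac ('X_i2 : R) / tofrac lform).
HB.instance Definition _ := GRing.RMorphism.copy rehom
  (bieval mconst_frac (tofrac ('X_i1 : R) / tofrac lform) (tofrac ('X_i2 : R) / tofrac lform)).
Arguments rehom : simpl never.

Lemma rehomC k : rehom (iota k) = tofrac (k%:MP : R).
Proof. exact: bievalC. Qed.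

Lemma rehomX : rehom 'X%:P = tofrac ('X_i1 : R) / tofrac lform.
Proof. exact: bievalX. Qed.

Lemma rehomY : rehom 'X = tofrac ('X_i2 : R) / tofrac lform.
Proof. exact: bievalY. Qed.

Lemma rehom_chart i : rehom (chart i) = (tofrac lform)^-1 * tofrac ('X_i : R).
Proof.
have e1 : rehom (chart i1) = (tofrac lform)^-1 * tofrac ('X_i1 : R).
  by rewrite chart1 rehomX mulrC.
have e2 : rehom (chart i2) = (tofrac lform)^-1 * tofrac ('X_i2 : R).
  by rewrite chart2 rehomY mulrC.
case: (ord3P i) => -> //.
pose k1 : F := tofrac ((c ^+ i1)%:MP : R); pose k2 : F := tofrac ((c ^+ i2)%:MP : R).
have eqL : tofrac lform =
    tofrac ('X_ord0 : R) + k1 * tofrac ('X_i1 : R) + k2 * tofrac ('X_i2 : R).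
  rewrite /lform ord3_sum !(rmorphD (@tofrac R)) /= !(rmorphM (@tofrac R)) /= expr0.
  by rewrite mpolyC1 (rmorph1 (@tofrac R)) mul1r.
have eq1 : rehom (chart ord0) + k1 * rehom (chart i1) + k2 * rehom (chart i2) = 1.
  have := sum_chart; rewrite ord3_sum.
  move: (chart ord0) (chart i1) (chart i2) => q0 q1 q2 /(congr1 rehom).
  rewrite (rmorph1 rehom) !(rmorphD rehom) /= !(rmorphM rehom) /= !rehomC expr0.
  by rewrite mpolyC1 (rmorph1 (@tofrac R)) mul1r.
have -> : rehom (chart ord0) = 1 - k1 * rehom (chart i1) - k2 * rehom (chart i2).
  by rewrite -eq1; ring.
have invL : tofrac lform * (tofrac lform)^-1 = 1 by rewrite mulfV.
apply: (mulfI nzL); rewrite mulrA invL mul1r e1 e2.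
transitivity (tofrac lform - (tofrac lform * (tofrac lform)^-1) *
    (k1 * tofrac ('X_i1 : R) + k2 * tofrac ('X_i2 : R))); first by ring.
by rewrite invL eqL; ring.
Qed.

Lemma rehom_dehom d f : f \is d.-homog -> tofrac lform ^+ d * rehom (dehom f) = tofrac f.
Proof.
move=> hf; rewrite (rmorph_mmap rehom).
have -> : mmap (rehom \o iota (K:=K)) (rehom \o chart) f =
    mmap (@tofrac R \o @mpolyC 3 K) (fun i => (tofrac lform)^-1 * tofrac ('X_i : R)) f.
  by apply: eq_mmap => [k|i] /=; [rewrite rehomC|rewrite rehom_chart].
rewrite (mmap_dhomog _ _ _ hf) mulrA -exprMn mulfV // expr1n mul1r.
have /= <- := rmorph_mmap (@tofrac R) (@mpolyC 3 K) (fun i => 'X_i) f.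
congr tofrac; rewrite [RHS]mpolyE; apply: eq_bigr => m _.
by rewrite mul_mpolyC mmap1_id.
Qed.

(** The exponent [n - (i + j)] is truncated, so this is a form of degree [n] only under
    [deg_le n f]. *)
Definition homogenize n (f : A) : R :=
  \sum_(j < size f) \sum_(i < size f`_j)
    (f`_j`_i)%:MP * (lform ^+ (n - (i + j)) * 'X_i1 ^+ i * 'X_i2 ^+ j).

Lemma dehom_homogenize n f : dehom (homogenize n f) = f.
Proof.
rewrite [RHS]bipolyE (rmorph_sum dehom) /=; apply: eq_bigr => j _.
rewrite (rmorph_sum dehom) /=; apply: eq_bigr => i _.
rewrite !(rmorphM dehom) /= !(rmorphXn dehom) /= dehomC dehom_lform expr1n mul1r.
by rewrite !dehomX chart1 chart2 mulrA.
Qed.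

Lemma lform_homog : lform \is 1.-homog.
Proof.
rewrite /lform; elim/big_ind: _ => [|x y|i _]; [exact: dhomog0|exact: dhomogD|].
by rewrite mul_mpolyC; apply: dhomogZ; rewrite dhomogX; apply/eqP; apply: mdeg1.
Qed.

Lemma homogenize_homog n f : deg_le n f -> homogenize n f \is n.-homog.
Proof.
move=> df; rewrite /homogenize.
elim/big_ind: _ => [|x y|j _]; [exact: dhomog0|exact: dhomogD|].
elim/big_ind: _ => [|x y|i _]; [exact: dhomog0|exact: dhomogD|].
have [lt|le] := ltnP n (i + j).
  by rewrite (deg_le_coef df lt) mpolyC0 mul0r; apply: dhomog0.
rewrite mul_mpolyC; apply: dhomogZ.
have XH (l : 'I_3) : ('X_l : R) \is 1.-homog by rewrite dhomogX; apply/eqP; apply: mdeg1.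
have := dhomogM (dhomogM (dhomogMn (n - (i + j)) lform_homog) (dhomogMn i (XH i1)))
  (dhomogMn j (XH i2)).
by rewrite !mul1n -addnA subnK.
Qed.

Lemma tofrac_homogenize n f : deg_le n f ->
  tofrac (homogenize n f) = tofrac lform ^+ n * rehom f.
Proof.
by move=> df; rewrite -(rehom_dehom (homogenize_homog df)) dehom_homogenize.
Qed.

End Dehomogenization.

(** * Irreducible forms read in the chart *)

Section IrreducibleTransfer.
Variables (K : closedFieldType) (c : K).
Local Notation R := {mpoly K[3]}.

Lemma mconstantE (f : R) : mconstant f -> exists k, f = k%:MP.
Proof. by move/msize1_polyC => ->; exists f@_0. Qed.

Lemma mconstantC (k : K) : mconstant (k%:MP : R).
Proof. by rewrite /mconstant msizeC; case: (k == 0). Qed.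

Lemma lform_nonconst : ~ mconstant (lform c).
Proof.
move/mconstantE => [k def_l]; have := lform_homog c; rewrite def_l => h1.
have nzk : k%:MP != 0 :> R by rewrite -def_l lform_neq0.
have h0 : k%:MP \is [in K[3], 0.-homog].
  by rewrite -[_%:MP]mulr1 mul_mpolyC; apply: dhomogZ; apply: dhomog1.
by have := dhomog_uniq nzk h0 h1.
Qed.

Lemma eq_tofrac (f h : R) : tofrac f = tofrac h -> f = h.
Proof. by move/eqP; rewrite tofrac_eq => /eqP. Qed.

Lemma dehom_eq0 d (f : R) : f \is d.-homog -> dehom c f = 0 -> f = 0.
Proof.
move=> hf f0; apply: eq_tofrac.
by rewrite -(rehom_dehom c hf) f0 (rmorph0 (rehom c)) (rmorph0 (@tofrac R)) mulr0.
Qed.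

Variables (g : R) (gam : nat).
Hypotheses (irg : mirreducible g) (hg : g \is gam.-homog).
Hypothesis nlg : ~ exists u, g = lform c * u%:MP.

Lemma mirreducible_neq0 : g != 0.
Proof.
case: irg => ncg _; apply/eqP => g0; apply: ncg.
by rewrite g0 -(mpolyC0 3); apply: mconstantC.
Qed.

(** A drop in degree would make [lform c] divide [g], hence equal it up to a constant, which [nlg]
    excludes. *)
Lemma size_chi_dehom : size (chi (0, 0) (dehom c g)) = gam.+1.
Proof.
apply/eqP; rewrite eqn_leq (deg_le_dehom c hg) ltnNge; apply/negP => le_g.
case def_gam: gam => [|e] in le_g.
  move: le_g; rewrite leqn0 size_poly_eq0 chi_eq0 => /eqP/(dehom_eq0 hg) g0.
  by move: mirreducible_neq0; rewrite g0 eqxx.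
apply: nlg; have def_g : g = lform c * homogenize c e (dehom c g).
  apply: eq_tofrac; rewrite (rmorphM (@tofrac R)) /= tofrac_homogenize //.
  by rewrite mulrA -exprS -def_gam rehom_dehom.
have [/lform_nonconst//|/mconstantE[u def_u]] := irg.2 _ _ def_g.
by exists u; rewrite -def_u.
Qed.

(** As [dehom c g] has degree exactly [gam], the degrees of its factors add up to [gam], and
    homogenizing them factors [g] itself, with no leftover power of [lform c]. *)
Lemma dehom_irreducible : birreducible (dehom c g).
Proof.
have nzg := mirreducible_neq0.
split=> [[k def_k]|a b def_ab].
  have g0 : gam = 0%N.
    by have := deg_le_iota k; rewrite -def_k /deg_le size_chi_dehom; case: gam.
  case: irg => ncg _; apply: ncg.
  suff -> : g = k%:MP by apply: mconstantC.
  apply: eq_tofrac; rewrite -(rehom_dehom c hg) g0 expr0 mul1r def_k.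
  by rewrite rehomC.
have nzab : a * b != 0.
  by rewrite -def_ab; apply: contraNneq nzg => /(dehom_eq0 hg)->.
move: (nzab); rewrite mulf_eq0 negb_or => /andP[nza nzb].
have sa : (size (chi (0, 0) a)).-1.+1 = size (chi (0, 0) a).
  by rewrite prednK // size_poly_gt0 chi_eq0.
have sb : (size (chi (0, 0) b)).-1.+1 = size (chi (0, 0) b).
  by rewrite prednK // size_poly_gt0 chi_eq0.
set al := (size (chi (0, 0) a)).-1 in sa; set be := (size (chi (0, 0) b)).-1 in sb.
have da : deg_le al a by rewrite /deg_le sa.
have db : deg_le be b by rewrite /deg_le sb.
have def_gam : gam = (al + be)%N.
  have := size_chi_dehom; rewrite def_ab (rmorphM (chi _)) size_mul ?chi_eq0 //= -sa -sb.
  by rewrite addSn addnS => -[].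
have def_g : g = homogenize c al a * homogenize c be b.
  apply: eq_tofrac; rewrite (rmorphM (@tofrac R)) /= !tofrac_homogenize //.
  by rewrite mulrACA -exprD -def_gam -(rmorphM (rehom c)) /= -def_ab rehom_dehom.
have [/mconstantE[k def_k]|/mconstantE[k def_k]] := irg.2 _ _ def_g; [left|right];
by exists k; rewrite -(dehomC c) -def_k dehom_homogenize.
Qed.

End IrreducibleTransfer.

(** * Powers of the ideal of a point and order in the chart *)

Section FatPoints.
Variables (K : closedFieldType) (c : K) (P : 'I_3 -> K).
Hypothesis lP : linf c P != 0.
Local Notation A := {poly {poly K}}.
Local Notation R := {mpoly K[3]}.

Let i1 : 'I_3 := inord 1.
Let i2 : 'I_3 := inord 2.

Definition affine_pt : K * K := (P i1 / linf c P, P i2 / linf c P).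

Lemma meval_lform (v : 'I_3 -> K) : (lform c).@[v] = linf c v.
Proof.
rewrite /lform (rmorph_sum (meval v)) /=; apply: eq_bigr => i _.
by rewrite mevalM mevalC mevalXU.
Qed.

Lemma eval_chart i : (fiber affine_pt.1 (chart c i)).[affine_pt.2] = (linf c P)^-1 * P i.
Proof.
have e1 : (fiber affine_pt.1 (chart c i1)).[affine_pt.2] = (linf c P)^-1 * P i1.
  by rewrite chart1 fiberC hornerC hornerX mulrC.
have e2 : (fiber affine_pt.1 (chart c i2)).[affine_pt.2] = (linf c P)^-1 * P i2.
  by rewrite chart2 /fiber map_polyX hornerX mulrC.
case: (ord3P i) => -> //.
have := sum_chart c; rewrite ord3_sum -/i1 -/i2.
move: (chart c ord0) (chart c i1) (chart c i2) e1 e2 => q0 q1 q2 e1 e2.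
move/(congr1 (fun q => (fiber affine_pt.1 q).[affine_pt.2])).
rewrite (rmorph1 (fiber _)) !(rmorphD (fiber _)) /= !(rmorphM (fiber _)) /=.
rewrite !hornerD !hornerM e1 e2 /iota !fiberC !hornerC expr0 mul1r => eq1.
apply: (mulfI lP); rewrite mulrA mulfV // mul1r.
have -> : (fiber affine_pt.1 q0).[affine_pt.2] =
    1 - c ^+ i1 * ((linf c P)^-1 * P i1) - c ^+ i2 * ((linf c P)^-1 * P i2).
  by rewrite -eq1; ring.
have invL : linf c P * (linf c P)^-1 = 1 by rewrite mulfV.
transitivity (linf c P - (linf c P * (linf c P)^-1) *
    (c ^+ i1 * P i1 + c ^+ i2 * P i2)); first by ring.
by rewrite invL /linf ord3_sum -/i1 -/i2 expr0; ring.
Qed.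

(** The chart evaluates at the representative of [P] on which [lform c] is 1, one of the multiples
    over which [in_IP] quantifies. *)
Lemma eval_dehom (f : R) :
  (fiber affine_pt.1 (dehom c f)).[affine_pt.2] = f.@[fun i => (linf c P)^-1 * P i].
Proof.
pose ev : {rmorphism A -> K} := horner_eval affine_pt.2 \o fiber affine_pt.1.
transitivity (mmap (ev \o @iota K) (ev \o chart c) f).
  exact: (rmorph_mmap ev).
apply: eq_mmap => [k|i] /=.
  by rewrite /horner_eval /iota fiberC !hornerC.
by rewrite /horner_eval eval_chart.
Qed.

Lemma in_IPpow_ord_ge k (f : R) : in_IPpow P k f -> ord_ge affine_pt k (dehom c f).
Proof.
case=> s [-> sP]; have so := subspace_ord_ge affine_pt k.
rewrite (rmorph_sum (dehom c)) /= big_seq; elim/big_ind: _ => [|x y|x /sP[<- IPx]].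
- by case: so.
- exact: (subspaceD so).
rewrite (rmorphM (dehom c)) /=; apply: ord_geMl.
elim: (x.2) IPx => [|h hs IHhs] IPx; first by [].
rewrite big_cons (rmorphM (dehom c)) /= -add1n; apply: ord_geM; last first.
  by apply: IHhs => h' hs_h'; apply: IPx; rewrite inE hs_h' orbT.
case=> // _; rewrite chi_coef0 eval_dehom.
by rewrite (IPx h (mem_head _ _)) polyC0.
Qed.

Lemma in_IPpow0 k : in_IPpow P k 0.
Proof. by exists [::]; rewrite big_nil. Qed.

Lemma in_IPpowD k (f h : R) : in_IPpow P k f -> in_IPpow P k h -> in_IPpow P k (f + h).
Proof.
case=> s [-> sP] [s' [-> sP']]; exists (s ++ s'); rewrite big_cat; split=> // x.
by rewrite mem_cat => /orP[/sP|/sP'].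
Qed.

Lemma in_IPpowM k (f h : R) : in_IPpow P k f -> in_IPpow P k (h * f).
Proof.
case=> s [-> sP]; exists [seq (h * x.1, x.2) | x <- s]; split=> [|x].
  by rewrite big_map mulr_sumr; apply: eq_bigr => x _; rewrite mulrA.
by case/mapP=> y /sP sy ->.
Qed.

Lemma in_IPpow_prod k (hs : seq R) : (k <= size hs)%N ->
  (forall h, h \in hs -> in_IP P h) -> in_IPpow P k (\prod_(h <- hs) h).
Proof.
move=> le_k IPh; exists [:: (\prod_(h <- drop k hs) h, take k hs)]; split.
  by rewrite big_seq1 /= mulrC -big_cat cat_take_drop.
move=> x; rewrite inE => /eqP-> /=; split; first exact: size_takel.
by move=> h /mem_take; apply: IPh.
Qed.

Lemma in_IP_coord i a : P i = a * linf c P -> in_IP P ('X_i - a%:MP * lform c).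
Proof.
move=> def_a k; rewrite mevalB mevalM mevalC mevalXU meval_lform.
have -> : linf c (fun j => k * P j) = k * linf c P.
  by rewrite /linf mulr_sumr; apply: eq_bigr => j _; rewrite mulrCA.
by rewrite def_a; ring.
Qed.

Lemma ord_ge_coef (Q : K * K) k (f : A) i j : ord_ge Q k f -> (i + j < k)%N ->
  (shift Q f)`_j`_i = 0.
Proof.
move=> of_ lt; have := coef_chi0 (shift Q f) (i + j) j.
by rewrite leq_addl addnK -chi_shift of_ // coef0 => <-.
Qed.

Lemma deg_le_shift (Q : K * K) n (f : A) : deg_le n f -> deg_le n (shift Q f).
Proof.
move=> df; have sd := subspace_deg_le K n.
rewrite shiftE; apply: (subspace_sum sd) => j; apply: (subspace_sum sd) => i.
have [lt|le] := ltnP n (i + j).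
  by rewrite (deg_le_coef df lt) iota0 !mul0r; case: sd.
rewrite -mulrA; apply: (subspaceZ _ sd); apply: (deg_leW le).
have d0 k : deg_le 1 (iota k) by apply: deg_leW (deg_le_iota k).
apply: deg_leM; rewrite -[X in deg_le X]muln1; apply/deg_leXn/deg_leD => //.
  exact: deg_leX.
exact: deg_leY.
Qed.

(** Expanded at the point, [f] has only terms of degree at least [k] in the translated coordinates;
    each homogenizes to a multiple of a product of at least [k] linear forms vanishing at [P]. *)
Lemma homogenize_in_IPpow n k (f : A) : deg_le n f -> ord_ge affine_pt k f ->
  in_IPpow P k (homogenize c n f).
Proof.
move=> df of_; set Q := affine_pt in of_; pose f' := shift Q f.
have df' : deg_le n f' := deg_le_shift Q df.
pose y1 : R := 'X_i1 - (Q.1)%:MP * lform c; pose y2 : R := 'X_i2 - (Q.2)%:MP * lform c.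
(* The homogenized Taylor expansion: the translated coordinates become the linear forms [y1] and
   [y2]. *)
suff -> : homogenize c n f = \sum_(j < size f') \sum_(i < size f'`_j)
    (f'`_j`_i)%:MP * lform c ^+ (n - (i + j)) * (y1 ^+ i * y2 ^+ j).
  elim/big_ind: _ => [|x y|j _]; [exact: in_IPpow0|exact: in_IPpowD|].
  elim/big_ind: _ => [|x y|i _]; [exact: in_IPpow0|exact: in_IPpowD|].
  have [lt|le] := ltnP (i + j) k.
    by rewrite (ord_ge_coef of_ lt) mpolyC0 !mul0r; apply: in_IPpow0.
  apply: in_IPpowM.
  have -> : y1 ^+ i * y2 ^+ j = \prod_(h <- nseq i y1 ++ nseq j y2) h.
    by rewrite big_cat !big_nseq !iter_mulr_1.
  apply: in_IPpow_prod; first by rewrite size_cat !size_nseq.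
  move=> h; rewrite mem_cat !mem_nseq => /orP[]/andP[_ /eqP->];
  by apply: in_IP_coord; rewrite divfK.
have nzL : tofrac (lform c) != 0 by rewrite tofrac_eq0 lform_neq0.
apply: eq_tofrac; rewrite tofrac_homogenize //.
have -> : f = shift (- Q.1, - Q.2) f' by rewrite /f'; case: (Q) => a b; rewrite shiftK.
rewrite shiftE (rmorph_sum (rehom c)) mulr_sumr [RHS](rmorph_sum (@tofrac R)).
apply: eq_bigr => j _ /=.
rewrite (rmorph_sum (rehom c)) mulr_sumr [RHS](rmorph_sum (@tofrac R)).
apply: eq_bigr => i _ /=.
have [lt|le] := ltnP n (i + j).
  rewrite (deg_le_coef df' lt) iota0 !mul0r (rmorph0 (rehom c)) mulr0.
  by rewrite ?mpolyC0 ?mul0r (rmorph0 (@tofrac R)).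
rewrite !(rmorphM (rehom c)) !(rmorphXn (rehom c)) /=.
rewrite !(rmorphD (rehom c)) /= !rehomC rehomX rehomY -/i1 -/i2.
rewrite !(rmorphM (@tofrac R)) !(rmorphXn (@tofrac R)) /=.
have E (a : K) (l : 'I_3) : tofrac ('X_l : R) / tofrac (lform c) + tofrac ((- a)%:MP : R)
    = (tofrac (lform c))^-1 * tofrac ('X_l - a%:MP * lform c : R).
  rewrite (rmorphB (@tofrac R)) /= (rmorphM (@tofrac R)) /= mpolyCN (rmorphN (@tofrac R)) /=.
  by rewrite mulrBr mulrC; congr (_ - _); rewrite mulrCA mulVf // mulr1.
rewrite !E -/y1 -/y2 !exprMn.
rewrite -{1}(subnK le) [in LHS]exprD exprD.
have invE l : tofrac (lform c) ^+ l * (tofrac (lform c))^-1 ^+ l = 1.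
  by rewrite -exprMn mulfV // expr1n.
transitivity ((tofrac (lform c) ^+ i * (tofrac (lform c))^-1 ^+ i) *
  (tofrac (lform c) ^+ j * (tofrac (lform c))^-1 ^+ j) *
  (tofrac (f'`_j`_i)%:MP * tofrac (lform c) ^+ (n - (i + j)) *
   (tofrac y1 ^+ i * tofrac y2 ^+ j))); first by ring.
by rewrite !invE !mul1r.
Qed.

End FatPoints.

(** * Congruence modulo the curve *)

Section CongruenceModCurve.
Variables (K : closedFieldType) (G : {poly {poly K}}).
Local Notation A := {poly {poly K}}.

Lemma congr_mul (x y x' y' : A) : divides G (x - y) -> divides G (x' - y') ->
  divides G (x * x' - y * y').
Proof.
case=> q def_q [q' def_q']; exists (q * x' + y * q').
have -> : x * x' - y * y' = (x - y) * x' + y * (x' - y') by ring.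
by rewrite def_q def_q'; ring.
Qed.

Lemma congr_exp (x y : A) n : divides G (x - y) -> divides G (x ^+ n - y ^+ n).
Proof.
move=> xy; elim: n => [|n IHn]; first by exists 0; rewrite subrr mulr0.
by rewrite !exprS; apply: congr_mul.
Qed.

Lemma congr_mmap (u v : 'I_3 -> A) (p : {mpoly K[3]}) :
    (forall i, divides G (u i - v i)) ->
  divides G (mmap (@iota K) u p - mmap (@iota K) v p).
Proof.
move=> uv; rewrite /mmap -sumrB.
have sG := subspace_divides G.
elim/big_ind: _ => [|x y|m _]; [by case: sG|exact: (subspaceD sG)|].
rewrite -mulrBr; apply: divides_mul; rewrite /mmap1.
elim: (index_enum _) => [|i s IHs]; first by rewrite !big_nil subrr; case: sG.
by rewrite !big_cons; apply: congr_mul => //; apply: congr_exp.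
Qed.

End CongruenceModCurve.

(** * The parametrization obtained from the pencil *)

Section PencilParametrization.
Variables (K : closedFieldType) (c : K) (g : {mpoly K[3]}) (gam : nat).
Local Notation A := {poly {poly K}}.
Hypothesis hg : g \is gam.-homog.
Hypothesis irG : birreducible (dehom c g).
Variables (M H0 H1 : A) (a : 'I_3 -> {poly K}).
Let G := dehom c g.
Hypothesis nGM : ~ divides G M.
Hypothesis indH : forall c0 c1, divides G (iota c0 * H0 + iota c1 * H1) ->
  c0 = 0 /\ c1 = 0.
Hypothesis sa : forall i, (size (a i) <= gam.+1)%N.
Hypothesis aP : forall i, divides G (M * chart c i - binary_form H0 H1 gam (a i)).

Let prG : bprime G := birreducible_prime irG.

Lemma poly_eq0_fun (p : {poly K}) : (forall t, p.[t] = 0) -> p = 0.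
Proof.
move=> p0; apply/eqP; apply: contraT => /(exists_notin [::])[t _].
by rewrite p0 eqxx.
Qed.

(** If [g] at the [a i] were a nonzero polynomial, the corresponding binary form of degree
    [gam * gam] in [H0] and [H1] would not vanish on the curve. Modulo [G], however, it is [g] at
    the [M * chart c i], that is [M ^+ gam * G]. *)
Lemma param_on_curve t : g.@[fun i => (a i).[t]] = 0.
Proof.
pose p : {poly K} := mmap (@polyC K) a g.
have -> : g.@[fun i => (a i).[t]] = p.[t].
  rewrite -[p.[t]]/(horner_eval t p) (rmorph_mmap (horner_eval t)).
  by apply: eq_mmap => [k|i] /=; rewrite /horner_eval ?hornerC.
suff -> : p = 0 by rewrite horner0.
apply: NNPP => /eqP nzp.
pose f : A := mmap (@iota K) (fun i => binary_form H0 H1 gam (a i)) g.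
have def_f : tofrac f = tofrac H1 ^+ (gam * gam) * pencil_value H0 H1 p.
  rewrite (rmorph_mmap (@tofrac A)).
  transitivity (mmap (@frac_const K)
      (fun i => tofrac H1 ^+ gam * pencil_value H0 H1 (a i)) g).
    by apply: eq_mmap => [k|i] //=; apply: (tofrac_binary_form indH).
  rewrite (mmap_dhomog _ _ _ hg) exprM; congr (_ * _).
  rewrite (rmorph_mmap (pencil_value H0 H1)); apply: eq_mmap => [k|i] //=.
  by rewrite pencil_valueC.
apply: (binary_form_not_divides prG indH nzp def_f).
have Gf : divides G (mmap (@iota K) (fun i => M * chart c i) g - f).
  exact: congr_mmap.
have sG := subspace_divides G.
rewrite -[f]opprK -sub0r -[0](subrr (mmap (@iota K) (fun i => M * chart c i) g)).
have -> : forall x : A, x - x - - f = x - (x - f) by move=> x; ring.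
apply: (subspaceB sG) => //; rewrite (mmap_dhomog _ _ _ hg).
by apply: divides_mul; exists 1; rewrite mulr1.
Qed.

Lemma binary_formZ k p : binary_form H0 H1 gam (k *: p) = iota k * binary_form H0 H1 gam p.
Proof.
rewrite /binary_form mulr_sumr; apply: eq_bigr => i _.
by rewrite coefZ (rmorphM (@iota K)) /= mulrA.
Qed.

Lemma binary_form0 : binary_form H0 H1 gam 0 = 0.
Proof. by rewrite -(scale0r 0) binary_formZ iota0 mul0r. Qed.

Lemma sum_iota_chart (x : A) : x = \sum_(i < 3) iota (c ^+ i) * (x * chart c i).
Proof.
under eq_bigr do rewrite mulrCA.
by rewrite -mulr_sumr sum_chart mulr1.
Qed.

(** The combination of the [chart c i] equal to 1 recovers [M] from the products [M * chart c i]. *)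
Lemma param_neq0 : exists j, a j != 0.
Proof.
apply: NNPP => a0; apply: nGM; have sG := subspace_divides G.
rewrite (sum_iota_chart M); apply: (subspace_sum sG) => i; apply: divides_mul.
have -> : M * chart c i = M * chart c i - binary_form H0 H1 gam (a i); last exact: aP.
have -> : a i = 0 by apply: NNPP => /eqP nzi; apply: a0; exists i.
by rewrite binary_form0 subr0.
Qed.

(** If all values of [a] were proportional, the coordinates would be constant modulo [G] and the
    curve would be a single point, whereas it has infinitely many. *)
Lemma param_nonconst : exists t1 t2 : K,
  proj_distinct (fun i => (a i).[t1]) (fun i => (a i).[t2]).
Proof.
apply: NNPP => const; have sG := subspace_divides G.
have minor0 t1 t2 i j : (a i).[t1] * (a j).[t2] = (a j).[t1] * (a i).[t2].
  by apply/eqP; apply: contraT => ne; case: const; exists t1, t2, i, j.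
have [j nzj] := param_neq0.
have [t _ nzt] := exists_notin [::] nzj.
pose k i := (a i).[t]; have nzk : k j != 0 by [].
have eqa i : k j *: a i = k i *: a j.
  apply/eqP; rewrite -subr_eq0; apply/eqP; apply: poly_eq0_fun => t'.
  by rewrite hornerD hornerN !hornerZ mulrC minor0 mulrC subrr.
have Gij i : divides G (iota (k j) * chart c i - iota (k i) * chart c j).
  suff: divides G (M * (iota (k j) * chart c i - iota (k i) * chart c j)).
    by case/prG.2.
  have -> : M * (iota (k j) * chart c i - iota (k i) * chart c j) =
      iota (k j) * (M * chart c i - binary_form H0 H1 gam (a i)) -
      iota (k i) * (M * chart c j - binary_form H0 H1 gam (a j)).
    have := congr1 (binary_form H0 H1 gam) (eqa i); rewrite !binary_formZ => eqb.
    by rewrite [X in _ = X - _]mulrBr eqb; ring.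
  by apply: (subspaceB sG); apply: (subspaceZ _ sG); apply: aP.
pose l := linf c k.
(* Summing with weights [c ^+ i] turns the free coordinate into 1, so that [chart c j] itself
   becomes constant. *)
have Gl : divides G (iota (k j) - iota l * chart c j).
  have -> : iota (k j) - iota l * chart c j =
      \sum_(i < 3) iota (c ^+ i) * (iota (k j) * chart c i - iota (k i) * chart c j).
    under eq_bigr do rewrite mulrBr.
    rewrite sumrB -sum_iota_chart; congr (_ - _).
    rewrite /l /linf (rmorph_sum (@iota K)) /= mulr_suml; apply: eq_bigr => i _.
    by rewrite (rmorphM (@iota K)) /= mulrA.
  by apply: (subspace_sum sG) => i; apply: divides_mul.
have nzl : l != 0.
  apply/eqP => l0; move: Gl; rewrite l0 iota0 mul0r subr0.
  exact: not_divides_iota.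
have Gi i : divides G (iota l * chart c i - iota (k i)).
  suff: divides G (iota (k j) * (iota l * chart c i - iota (k i))).
    by case/prG.2 => // /(not_divides_iota prG nzk).
  have -> : iota (k j) * (iota l * chart c i - iota (k i)) =
      iota l * (iota (k j) * chart c i - iota (k i) * chart c j) -
      iota (k i) * (iota (k j) - iota l * chart c j) by ring.
  by apply: (subspaceB sG); apply: (subspaceZ _ sG); [exact: Gij|exact: Gl].
pose i1 : 'I_3 := inord 1; pose i2 : 'I_3 := inord 2.
have [P nP oP] := curve_point_notin [:: (k i1 / l, k i2 / l)] irG.
have ev0 f : divides G f -> (fiber P.1 f).[P.2] = 0.
  case=> h ->; have := chi_coef0 P G; rewrite oP // => /esym/eqP.
  by rewrite polyC_eq0 => /eqP G0; rewrite (rmorphM (fiber P.1)) /= hornerM G0 mul0r.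
move: nP; rewrite inE => /negP; apply; apply/eqP.
rewrite [P]surjective_pairing; congr (_, _); apply: (mulfI nzl);
  rewrite mulrC [RHS]mulrC divfK // mulrC; apply/eqP; rewrite -subr_eq0; apply/eqP.
  rewrite -[RHS](ev0 _ (Gi i1)) fiber_affine chart1 fiberC hornerC.
  by rewrite hornerX.
by rewrite -[RHS](ev0 _ (Gi i2)) fiber_affine chart2 /fiber map_polyX hornerX.
Qed.

End PencilParametrization.

(** * Choice of the chart and conclusion *)

Lemma lform_avoid (K : closedFieldType) r (Z : 'I_r -> 'I_3 -> K) :
  (forall i, pt_nonzero (Z i)) -> exists c, forall i, linf c (Z i) != 0.
Proof.
(* The value of [q i] at [c] is [linf c (Z i)], so [c] must avoid the roots of finitely many nonzero
   polynomials. *)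
move=> HZ; pose q i : {poly K} := \poly_(j < 3) Z i (inord j).
have nzq : \prod_i q i != 0.
  apply/prodf_neq0 => i _; have [j nzj] := HZ i; apply: contraNneq nzj => q0.
  have := congr1 (fun p : {poly K} => p`_j) q0.
  by rewrite coef0 coef_poly ltn_ord inord_val => ->.
have [c _] := exists_notin [::] nzq; rewrite horner_prod => /prodf_neq0 nz.
exists c => i; have := nz i isT; rewrite /q horner_poly /linf.
by under eq_bigr do rewrite inord_val mulrC.
Qed.

(** The line at infinity is not seen in the chart and is parametrized directly, by [x1 = 1] and
    [x2 = t]. *)
Lemma line_rational (K : closedFieldType) (c u : K) : rational_curve (lform c * u%:MP).
Proof.
pose a (i : 'I_3) : {poly K} := match val i with
  | 0 => (- c)%:P - (c ^+ 2) *: 'X | 1 => 1 | _ => 'X end.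
exists a; split=> [t|].
  rewrite mevalM meval_lform /linf ord3_sum /a /= !inordK //= !hornerE.
  by ring.
exists 0, 1, (inord 1), (inord 2).
by rewrite /a /= !inordK //= !hornerE oner_eq0.
Qed.

Theorem theorem4p1 (K : closedFieldType) (charK0 : [pchar K] =i pred0)
    (r : nat) (Z : 'I_r -> 'I_3 -> K) (HZ : forall i, pt_nonzero (Z i))
    (k : nat) (hk : (2 <= k)%N) (d e : nat)
    (hd : is_alpha (in_IkZ Z k) d) (he : is_alpha (in_IkZ Z k.-1) e)
    (hde : d = (e + 2)%N)
    (F : {mpoly K[3]}) (hF0 : F != 0) (hFd : F \is d.-homog)
    (hFZ : in_IkZ Z k F) :
  forall g : {mpoly K[3]}, irr_component g F -> rational_curve g.
Proof.
move=> g [irg [h def_F]].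
have [gam hg] := dhomog_factor hF0 hFd def_F.
have def_F' : F = h * g by rewrite def_F mulrC.
have [be hh] := dhomog_factor hF0 hFd def_F'.
have def_d : d = (gam + be)%N.
  by apply: dhomog_uniq hF0 hFd _; rewrite def_F; apply: dhomogM.
have nzh : h != 0 by apply: contraNneq hF0 => h0; rewrite def_F h0 mulr0.
have [c lZ] := lform_avoid HZ.
have [[u ->]|nlg] := classic (exists u, g = lform c * u%:MP).
  exact: line_rational.
have irG := dehom_irreducible irg hg nlg.
have degG := size_chi_dehom irg hg nlg.
have nzG := birreducible_neq0 irG.
(* Several indices may represent the same point, while codimensions are counted over duplicate-free
   lists. *)
pose L := undup [seq affine_pt c (Z i) | i <- enum 'I_r].
have [||M [H0 [H1 [nGM indH pM]]]] := rational_pencil irG degG (L := L).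
- exact: undup_uniq.
- move=> f g3 df of_.
  (* Its degree is [d - 3 = e - 1], below the initial degree of the ideal for [k - 1]. *)
  pose w := homogenize c (d - 3) (f * dehom c h).
  have dw : deg_le (d - 3) (f * dehom c h).
    rewrite (_ : d - 3 = gam - 3 + be)%N; last by lia.
    exact/deg_leM/deg_le_dehom.
  have w0 : w = 0.
    case: he => _ /(_ (d - 3)%N); apply; first by lia.
      exact: homogenize_homog.
    move=> i; apply: homogenize_in_IPpow => //.
    (* Of the order [k] of [F], [g] takes its multiplicity and [h] at least the rest; adding the
       multiplicity minus 1 from [f] makes at least [k - 1], also when a truncated difference is
       0. *)
    have oF := in_IPpow_ord_ge (lZ i) (hFZ i).
    rewrite def_F (rmorphM (dehom c)) /= in oF.
    have oh := ord_ge_divl nzG oF.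
    have LZ : affine_pt c (Z i) \in L by rewrite mem_undup map_f // mem_enum.
    have := ord_geM (of_ _ LZ) oh; apply: ord_geW.
    by move: (mult _ _); lia.
  have : f * dehom c h = 0.
    by rewrite -[LHS](dehom_homogenize c (d - 3)) -/w w0 (rmorph0 (dehom c)).
  move/eqP; rewrite mulf_eq0 => /orP[/eqP//|/eqP/(dehom_eq0 hh) h0].
  by rewrite h0 eqxx in nzh.
have /fin_all_exists2[a sa aP] i := pM _ (deg_le_chart c i).
exists a; split; first exact: (param_on_curve hg irG indH sa aP).
exact: (param_nonconst irG nGM aP).
Qed.
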